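(* Let $f(z)=z+\sum_{n\ge 2}a_nz^n\in\mathcal{BT}_{\mathfrak{B}}$. Then $$|a_2a_3-a_4|\le\frac18.$$ The inequality is sharp, with equality for $f_3(z)=\int_0^z\sqrt{1+\tanh(t^3)}\,dt$.
   Context: $\mathbb{D}=\{z\in\mathbb{C}:|z|<1\}$. $\mathcal{S}$ is the class of univalent analytic functions $f$ on $\mathbb{D}$ normalized by $f(0)=0$, $f'(0)=1$, i.e. $f(z)=z+\sum_{n\ge2}a_nz^n$. For analytic $g,h$ on $\mathbb{D}$, $g\prec h$ means there is an analytic $\omega:\mathbb{D}\to\mathbb{D}$ with $\omega(0)=0$ and $g=h\circ\omega$. Let $\mathfrak{B}(z)=\sqrt{1+\tanh z}$ (principal branch, $\mathfrak{B}(0)=1$). The class $\mathcal{BT}_{\mathfrak{B}}$ is $\{f\in\mathcal{S}: f'(z)\prec \mathfrak{B}(z)\}$. *)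

(* Defs.v *)
From HB Require Import structures.
From mathcomp Require Import all_boot all_order all_algebra.
From mathcomp Require Import all_classical all_reals all_analysis.
From mathcomp Require Import complex.
Set Implicit Arguments. Unset Strict Implicit. Unset Printing Implicit Defensive.
Import Order.TTheory GRing.Theory Num.Theory.
Import numFieldTopology.Exports numFieldNormedType.Exports.
Local Open Scope ring_scope.
Local Open Scope complex_scope.
Local Open Scope classical_set_scope.

(* topology / normed-module structure on R[i], viewed as a normed module over
   itself (the standard metric |z - w|), copied from the regular module R[i]^o *)
#[non_forgetful_inheritance]
HB.instance Definition _ (R : rcfType) := NormedModule.copy R[i] (R[i])^o.

Section Defs.
Variable R : realType.
Local Notation C := R[i].

Definition inD (z : C) : Prop := `|z| < 1.

Definition expC (z : C) : C :=
  (expR (complex.Re z))%:C * (cos (complex.Im z) +i* sin (complex.Im z)).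

Definition tanhC (z : C) : C := (expC (2 * z) - 1) / (expC (2 * z) + 1).

(* B(z) = sqrt(1 + tanh z), principal branch (sqrtc: Re >= 0, and
   Im >= 0 on the negative real axis); B(0) = 1 *)
Definition Bfun (z : C) : C := sqrtc (1 + tanhC z).

Definition power_series_on_D (f : C -> C) (a : nat -> C) : Prop :=
  forall z, inD z -> series (fun n => a n * z ^+ n) @ \oo --> f z.

Definition analytic_on_D (f : C -> C) : Prop :=
  exists a, power_series_on_D f a.

Definition subordinate (g h : C -> C) : Prop :=
  exists w : C -> C, [/\ analytic_on_D w, (forall z, inD z -> inD (w z)),
                        w 0 = 0 & forall z, inD z -> g z = h (w z)].

Definition classS (f : C -> C) : Prop :=
  [/\ analytic_on_D f, (forall z1 z2, inD z1 -> inD z2 -> f z1 = f z2 -> z1 = z2),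
      f 0 = 0 & f^`() 0 = 1].

Definition classBT (f : C -> C) : Prop := classS f /\ subordinate f^`() Bfun.

End Defs.

(* Main.v *)
Require Import Defs.
From HB Require Import structures.
From mathcomp Require Import all_boot all_order all_algebra.
From mathcomp Require Import all_classical all_reals all_analysis.
From mathcomp Require Import complex ring lra.
From mathcomp Require Import cyclic separable cyclotomic.
Import Order.TTheory GRing.Theory Num.Theory.
Import numFieldTopology.Exports numFieldNormedType.Exports.
Local Open Scope ring_scope.
Local Open Scope complex_scope.
Local Open Scope classical_set_scope.
Set Implicit Arguments.
Unset Strict Implicit.
Unset Printing Implicit Defensive.

(* With T = tanh and Y = sqrt (1 + tanh), the equations T' = 1 - T^2 and
   Y' = Y (1 - T) / 2 give recurrences showing by an immediate induction that
   all Taylor coefficients of T and Y are bounded by 1.  Hence both series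
   converge on the unit disc, where uniqueness for linear equations identifies
   them with tanh and the principal root; moreover Re Y > 0 there.

   If f' = Y o w with w = c1 z + c2 z^2 + c3 z^3 + ... a Schwarz function, then
   Y = 1 + z/2 - z^2/8 - 5 z^3/48 + ... yields
     a2 a3 - a4 = - (c3 - 5/6 c1 c2 - 1/8 c1^3) / 8,
   and Parseval's inequality |c1|^2 + |c2|^2 + |c3|^2 <= 1 (averaging over roots
   of unity) already bounds the bracket by 1.

   For f3' = Y (z^3), univalence follows from Re f3' > 0 and the mean value
   theorem along segments. *)

(** * Power series with radius of convergence at least one *)

Section PowerSeries.
Variable R : realType.
Local Notation C := R[i].
Implicit Types (a b : nat -> C) (z s h M K e : C).

(** Radius of convergence one is what subordination asks for, since a Schwarz function takes its
    values in the disc; it comes from the recurrences alone, without locating the poles of [tanh].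
    Both [Y^2] and [1 + tanh] solve [G' = (1 - tanh) G], so uniqueness makes them equal. This fixes
    [Y] only up to sign; [Re Y > 0] selects the principal branch, and it holds by continuity along
    rays from [Y(0) = 1] because [Y] never meets the imaginary axis. The bound [1/8] is the factor
    [b1 / 4] of [c3] in [a4], attained at [c3 = 1], that is, for the Schwarz function [z^3]. The
    factors [5/6] and [1/8] of the other two terms are small enough for the square-sum bound to
    absorb them. Expanding [Y o w] to third order uses no theorem on composing power series: the
    remainders are kept as mere functions bounded near 0. *)

Definition tame a :=
  forall s, 0 <= s -> s < 1 -> exists K, forall n, `|a n| * s ^+ n <= K.

(* [lim] is a junk value where the series diverges; [psumP] covers the unit disc. *)
Definition psum a z : C := lim (series (fun n => a n * z ^+ n) @ \oo).

Definition dcoef a : nat -> C := fun n => n.+1%:R * a n.+1.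

Definition conv a b : nat -> C := fun n => \sum_(i < n.+1) a i * b (n - i)%N.

Lemma mid_lt1 s : 0 <= s -> s < 1 ->
  [/\ s < (1 + s) / 2, 0 < (1 + s) / 2 & (1 + s) / 2 < 1].
Proof.
move=> s0 s1; split.
- by rewrite ltr_pdivlMr// mulr_natr mulr2n ltrD2r.
- by rewrite divr_gt0// ltr_pwDl.
- by rewrite ltr_pdivrMr// mul1r ltrD2l.
Qed.

Lemma geometric_sum_le (q : C) N : 0 <= q -> q < 1 ->
  \sum_(n < N) q ^+ n <= (1 - q)^-1.
Proof.
move=> q0 q1; have q1' : 0 < 1 - q by rewrite subr_gt0.
rewrite -[leRHS]mul1r ler_pdivlMr// mulrC -opprB mulNr -subrX1 opprB.
by rewrite gerBl exprn_ge0.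
Qed.

(** Abel's lemma: with [r] halfway between [s] and 1, the bound on [|a n| r^n] leaves a geometric
    series of ratio [s / r]. *)
Lemma tame_summable a s : tame a -> 0 <= s -> s < 1 ->
  exists M, forall N, \sum_(n < N) `|a n| * s ^+ n <= M.
Proof.
move=> ta s0 s1; have [sr r0 r1] := mid_lt1 s0 s1.
set r := (1 + s) / 2 in sr r0 r1.
have [K HK] := ta r (ltW r0) r1.
have q0 : 0 <= s / r by rewrite divr_ge0// ltW.
have q1 : s / r < 1 by rewrite ltr_pdivrMr// mul1r.
have K0 : 0 <= K by apply: le_trans (HK 0%N); rewrite mulr1.
exists (K * (1 - s / r)^-1) => N.
apply: le_trans (_ : \sum_(n < N) K * (s / r) ^+ n <= _).
  apply: ler_sum => n _; have -> : `|a n| * s ^+ n = `|a n| * r ^+ n * (s / r) ^+ n.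
    by rewrite -mulrA -exprMn mulrCA divff ?mulr1// gt_eqF.
  by rewrite ler_wpM2r ?exprn_ge0.
by rewrite -mulr_sumr ler_wpM2l// geometric_sum_le.
Qed.

Lemma lim_norm_le (u : nat -> C) (l M : C) :
  u @ \oo --> l -> (forall n, `|u n| <= M) -> `|l| <= M.
Proof.
move=> ul uM; apply/ler_addgt0Pr => e e0.
move/cvgrPdist_lt: ul => /(_ e e0)[N _ /(_ N (leqnn N)) lN].
rewrite -(subrK (u N) l) (le_trans (ler_normD _ _))// addrC lerD//.
exact: ltW.
Qed.

Lemma norm_le_ReIm (z : C) :
  `|z| <= (`|complex.Re z| + `|complex.Im z|)%:C.
Proof.
rewrite [in leLHS](complexE z) (le_trans (ler_normD _ _))// normrM rmorphD/=.
rewrite lerD//; first by rewrite normc_def/= expr0n addr0 sqrtr_sqr.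
rewrite !normc_def/= !expr0n/= expr1n !addr0 add0r sqrtr1 mul1r sqrtr_sqr //.
Qed.

Lemma norm_Im_le (z : C) : (`|complex.Im z|)%:C <= `|z|.
Proof.
rewrite normc_def lecR -sqrtr_sqr ler_wsqrtr// lerDr sqr_ge0 //.
Qed.

Lemma cvg_ReIm (u : nat -> C) (x y : R) :
  (complex.Re (u n) @[n --> \oo] --> x) ->
  (complex.Im (u n) @[n --> \oo] --> y) ->
  u @ \oo --> (x +i* y : C).
Proof.
move=> /cvgrPdist_lt ux /cvgrPdist_lt uy; apply/cvgrPdist_lt => e e0.
have := e0; rewrite ltcE/= => /andP[/eqP im_e re_e].
have e2 : 0 < complex.Re e / 2 by rewrite divr_gt0.
near=> n; apply: le_lt_trans (norm_le_ReIm _) _.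
have -> : e = (complex.Re e)%:C.
  by rewrite -[LHS]RRe_real// realE ltW.
rewrite ltcR [ltRHS]splitr.
have -> : complex.Re ((x +i* y) - u n) = x - complex.Re (u n) by case: (u n).
have -> : complex.Im ((x +i* y) - u n) = y - complex.Im (u n) by case: (u n).
by rewrite ltrD//; near: n; [exact: ux|exact: uy].
Unshelve. all: by end_near.
Qed.

Lemma real_series_cvg (v : nat -> R) (M : R) :
  (forall N, \sum_(n < N) `|v n| <= M) -> cvgn (series v).
Proof.
move=> vM; apply: normed_cvg; apply: nondecreasing_is_cvgn.
  by apply: nondecreasing_series => n _ _; exact: normr_ge0.
by exists M => _ [n _ <-]; have := vM n; rewrite -(big_mkord xpredT (fun i => `|v i|)).
Qed.

Lemma Re_series (u : nat -> C) n :
  complex.Re (series u n) = series (fun k => complex.Re (u k)) n.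
Proof. by apply: (big_morph (@complex.Re R)) => // -[? ?] [? ?]. Qed.

Lemma Im_series (u : nat -> C) n :
  complex.Im (series u n) = series (fun k => complex.Im (u k)) n.
Proof. by apply: (big_morph (@complex.Im R)) => // -[? ?] [? ?]. Qed.

(** The modulus dominates real and imaginary parts, so absolutely convergent real series suffice. *)
Lemma abs_series_cvg (u : nat -> C) (M : C) :
  (forall N, \sum_(n < N) `|u n| <= M) -> exists l : C, series u @ \oo --> l.
Proof.
move=> uM.
have M0 : 0 <= M by have := uM 0%N; rewrite big_ord0.
have EM : M = (complex.Re M)%:C by rewrite -[LHS]RRe_real// realE M0.
have bnd (p : C -> R) : (forall z, (`|p z|)%:C <= `|z|) ->
    cvgn (series (fun k => p (u k))).
  move=> pz; apply: (@real_series_cvg _ (complex.Re M)) => N.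
  rewrite -lecR -EM; apply: le_trans (uM N).
  by rewrite rmorph_sum; apply: ler_sum => i _; exact: pz.
have /cvg_ex[x hx] := bnd _ (@normc_ge_Re _).
have /cvg_ex[y hy] := bnd _ norm_Im_le.
exists (x +i* y); apply: cvg_ReIm.
- by under eq_fun do rewrite Re_series.
- by under eq_fun do rewrite Im_series.
Qed.

Lemma psumP a z : tame a -> `|z| < 1 ->
  series (fun n => a n * z ^+ n) @ \oo --> psum a z.
Proof.
move=> ta z1; have [M HM] := tame_summable ta (normr_ge0 z) z1.
have [|l hl] := @abs_series_cvg (fun n => a n * z ^+ n) M.
  by move=> N; under eq_bigr do rewrite normrM normrX; exact: HM.
have -> // : psum a z = l.
exact: (cvg_lim (@norm_hausdorff C C)).
Qed.

Lemma psum_unique a z (l : C) :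
  series (fun n => a n * z ^+ n) @ \oo --> l -> psum a z = l.
Proof. exact: (cvg_lim (@norm_hausdorff C C)). Qed.

Lemma psum_norm_le a z (M : C) : tame a -> `|z| < 1 ->
  (forall N, \sum_(n < N) `|a n| * `|z| ^+ n <= M) -> `|psum a z| <= M.
Proof.
move=> ta z1 HM; apply: lim_norm_le (psumP ta z1) _ => N.
rewrite /series/= big_mkord; apply: le_trans (ler_norm_sum _ _ _) _.
by under eq_bigr do rewrite normrM normrX.
Qed.

Lemma tame_bound a K : (forall n, `|a n| <= K) -> tame a.
Proof.
move=> aK s s0 s1; exists K => n; apply: le_trans (aK n).
by rewrite ler_piMr// exprn_ile1// ltW.
Qed.

Lemma tame_psum_bounded a s : tame a -> 0 <= s -> s < 1 ->
  exists M, forall z, `|z| <= s -> `|psum a z| <= M.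
Proof.
move=> ta s0 s1; have [M HM] := tame_summable ta s0 s1; exists M => z zs.
apply: (psum_norm_le ta) => [|N]; first exact: le_lt_trans s1.
apply: le_trans (HM N); apply: ler_sum => n _.
by rewrite ler_wpM2l// lerXn2r// nnegrE.
Qed.

Lemma psumD a b z : tame a -> tame b -> `|z| < 1 ->
  psum (fun n => a n + b n) z = psum a z + psum b z.
Proof.
move=> ta tb z1; apply: psum_unique.
rewrite (_ : series _ = series (fun n => a n * z ^+ n) + series (fun n => b n * z ^+ n)).
  by apply: cvgD; exact: psumP.
apply/funext => n; rewrite fctE /series/= !big_mkord -big_split/=.
by apply: eq_bigr => i _; rewrite mulrDl.
Qed.

Lemma psumZ a (k : C) z : tame a -> `|z| < 1 ->
  psum (fun n => k * a n) z = k * psum a z.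
Proof.
move=> ta z1; apply: psum_unique.
rewrite (_ : series _ = (fun n => k * series (fun n => a n * z ^+ n) n)).
  by apply: cvgMr; exact: psumP.
apply/funext => n; rewrite /series/= !big_mkord mulr_sumr.
by apply: eq_bigr => i _; rewrite mulrA.
Qed.

Lemma psum_cst (k : C) z : psum (fun n => if n == 0%N then k else 0) z = k.
Proof.
apply: psum_unique; apply/cvgrPdist_lt => e e0; exists 1%N => //= -[//|n] _.
rewrite /series/= big_nat_recl//= expr0 mulr1 big1 ?addr0 ?subrr ?normr0// => i _.
by rewrite mul0r.
Qed.

Lemma psum0 a : psum a 0 = a 0%N.
Proof.
apply: psum_unique; apply/cvgrPdist_lt => e e0; exists 1%N => //= -[//|n] _.
rewrite /series/= big_nat_recl//= expr0 mulr1 big1 ?addr0 ?subrr ?normr0// => i _.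
by rewrite exprS mul0r mulr0.
Qed.

Lemma tameZ a (k : C) : tame a -> tame (fun n => k * a n).
Proof.
move=> ta s s0 s1; have [K HK] := ta s s0 s1; exists (`|k| * K) => n.
by rewrite normrM -mulrA ler_wpM2l.
Qed.

Lemma tameD a b : tame a -> tame b -> tame (fun n => a n + b n).
Proof.
move=> ta tb s s0 s1; have [K HK] := ta s s0 s1; have [L HL] := tb s s0 s1.
exists (K + L) => n; apply: le_trans (lerD (HK n) (HL n)).
by rewrite -mulrDl ler_wpM2r ?exprn_ge0// ler_normD.
Qed.

Lemma tame_shift a : tame a -> tame (fun n => a n.+1).
Proof.
move=> ta s s0 s1; have [sr r0 r1] := mid_lt1 s0 s1.
set r := (1 + s) / 2 in sr r0 r1.
have [K HK] := ta r (ltW r0) r1; exists (K / r) => n.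
rewrite ler_pdivlMr//; apply: le_trans (HK n.+1); rewrite -mulrA ler_wpM2l//.
by rewrite exprSr ler_wpM2r ?(ltW r0)// lerXn2r ?nnegrE ?(ltW r0)// ltW.
Qed.

Lemma psum_shift a z : tame a -> `|z| < 1 ->
  psum a z = a 0%N + z * psum (fun n => a n.+1) z.
Proof.
move=> ta z1; apply: psum_unique; rewrite -cvg_shiftS.
rewrite (_ : (fun n => _) =
  (fun n => a 0%N + z * series (fun n => a n.+1 * z ^+ n) n)).
  apply: cvgD; first exact: cvg_cst.
  by apply: cvgMr; apply: psumP => //; exact: tame_shift.
apply/funext => n; rewrite /series/= !big_mkord big_ord_recl expr0 mulr1.
by rewrite mulr_sumr; congr +%R; apply: eq_bigr => i _; rewrite mulrCA -exprS.
Qed.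
End PowerSeries.

(** Multiplying the difference quotient by [h] removes division and the punctured neighbourhood. The
    criterion reads the same over [R] and [R[i]], which lets derivatives pass from one field to the
    other. *)
Lemma is_derive_epsP (K : numFieldType) (f : K -> K) (x l : K) :
  is_derive x 1 f l <-> forall e : K, 0 < e -> exists2 d : K, 0 < d &
    forall h : K, `|h| < d -> `|f (x + h) - f x - l * h| <= e * `|h|.
Proof.
pose q (h : K) := h^-1 *: ((f \o shift x) (h *: 1) - f x).
have qE h : h != 0 -> f (x + h) - f x - l * h = h * (q h - l).
  move=> h0; rewrite /q /= [h *: 1]mulr1 (addrC h).
  by rewrite mulrBr [h * (_ *: _)]mulrA divff// mul1r [h * l]mulrC.
split=> [[df dl] e e0|H].
  have : q @ 0^' --> l by rewrite -dl; exact: df.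
  move/cvgrPdist_lt => /(_ e e0); rewrite near_withinE.
  move=> /nbhs_ballP[d /= d0 Hd]; exists d => // h hd.
  have [->|h0] := eqVneq h 0; first by rewrite addr0 subrr mulr0 subrr !normr0 mulr0.
  have := Hd h; rewrite /ball/= sub0r normrN => /(_ hd h0) /ltW Hh.
  by rewrite qE// normrM mulrC ler_wpM2r// distrC.
have ql : q @ 0^' --> l.
  apply/cvgrPdist_le => e e0; have [d d0 Hd] := H _ e0.
  rewrite near_withinE; apply/nbhs_ballP; exists d => //= h.
  rewrite /ball/= sub0r normrN => hd h0; have := Hd _ hd.
  by rewrite qE// normrM mulrC ler_pM2r ?normr_gt0// distrC.
by split; [apply/cvg_ex; exists l|exact: (cvg_lim (@norm_hausdorff K K))].
Qed.

(** * Termwise differentiation *)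

Section Derivative.
Variable R : realType.
Local Notation C := R[i].
Implicit Types (a b : nat -> C) (z s h r d : C).

(** The truncated exponent [n.-1] is harmless at [n = 0], where the factor [n%:R] vanishes. *)
Definition taylor1 z h n := (z + h) ^+ n - z ^+ n - n%:R * z ^+ n.-1 * h.

Lemma taylor1S z h n :
  taylor1 z h n.+1 = (z + h) * taylor1 z h n + n%:R * z ^+ n.-1 * h ^+ 2.
Proof.
rewrite /taylor1 /= exprS [z ^+ n.+1]exprS -natr1; case: n => [|n] /=.
  by rewrite !expr0 !mul0r; ring.
by rewrite [z ^+ n.+1]exprS -natr1; ring.
Qed.

(* The remainder [taylor1 z h n] is [h ^ 2] times a polynomial with nonnegative
   coefficients, so it is majorized by its value at the moduli. *)
Lemma taylor1_le z h r d n : `|z| <= r -> 0 <= d -> `|h| <= d ->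
  d ^+ 2 * `|taylor1 z h n| <= `|h| ^+ 2 * taylor1 r d n.
Proof.
move=> zr d0 hd; have r0 : 0 <= r := le_trans (normr_ge0 z) zr.
elim: n => [|n IH].
  by rewrite /taylor1 !expr0 !mul0r !subr0 !subrr normr0 !mulr0.
rewrite !taylor1S (le_trans (ler_wpM2l _ (ler_normD _ _))) ?exprn_ge0//.
rewrite mulrDr [leRHS]mulrDr lerD//.
  rewrite normrM mulrCA [leRHS]mulrCA ler_pM ?mulr_ge0 ?exprn_ge0//.
  by rewrite (le_trans (ler_normD _ _))// lerD.
rewrite !normrM normr_nat !normrX.
rewrite [leLHS](_ : _ = `|z| ^+ n.-1 * (n%:R * `|h| ^+ 2 * d ^+ 2)); last by ring.
rewrite [leRHS](_ : _ = r ^+ n.-1 * (n%:R * `|h| ^+ 2 * d ^+ 2)); last by ring.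
by rewrite ler_wpM2r ?mulr_ge0 ?exprn_ge0// lerXn2r ?nnegrE.
Qed.

Lemma taylor1_ge0 r d n : 0 <= r -> 0 < d -> 0 <= taylor1 r d n.
Proof.
move=> r0 d0; have d0' := ltW d0.
have := @taylor1_le r d r d n; rewrite (ger0_norm r0) (ger0_norm d0') => /(_ (lexx _) d0' (lexx _)).
move=> /(le_trans (mulr_ge0 (exprn_ge0 2 d0') (normr_ge0 _))).
by rewrite pmulr_rge0// exprn_gt0.
Qed.

Lemma taylor1_le_exp r d n : 0 <= r -> 0 <= d -> taylor1 r d n <= (r + d) ^+ n.
Proof.
move=> r0 d0; rewrite /taylor1 -addrA gerDl -opprD oppr_le0.
by rewrite addr_ge0 ?exprn_ge0// !mulr_ge0// exprn_ge0.
Qed.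

(** The factor [n] created by differentiation is paid for by enlarging the radius from [r] to
    [r + d]. *)
Lemma dcoef_le r d n : 0 <= r -> 0 < d -> n%:R * r ^+ n.-1 * d <= (r + d) ^+ n.
Proof.
move=> r0 d0; have := taylor1_ge0 n r0 d0; rewrite subr_ge0 => /le_trans -> //.
by rewrite gerBl exprn_ge0.
Qed.

Lemma tame_dcoef a : tame a -> tame (dcoef a).
Proof.
move=> ta s s0 s1; have [sr r0 r1] := mid_lt1 s0 s1.
set r := (1 + s) / 2 in sr r0 r1.
have d0 : 0 < r - s by rewrite subr_gt0.
have [K HK] := ta r (ltW r0) r1; exists (K / (r - s)) => n.
rewrite ler_pdivlMr//; apply: le_trans (HK n.+1).
rewrite /dcoef normrM normr_nat.
have := dcoef_le n.+1 s0 d0; rewrite subrKC => H.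
rewrite (_ : n.+1%:R * `|a n.+1| * s ^+ n * (r - s) =
  `|a n.+1| * (n.+1%:R * s ^+ n.+1.-1 * (r - s))) /=; last by ring.
by rewrite ler_wpM2l.
Qed.

Lemma psum_taylor1 a z : tame a -> `|z| < 1 ->
  exists d M, 0 < d /\ forall h, `|h| <= d ->
    `|psum a (z + h) - psum a z - psum (dcoef a) z * h| <= M * `|h| ^+ 2.
Proof.
move=> ta z1; have [sr r0 r1] := mid_lt1 (normr_ge0 z) z1.
set r := (1 + `|z|) / 2 in sr r0 r1.
have d0 : 0 < r - `|z| by rewrite subr_gt0.
have [M HM] := tame_summable ta (ltW r0) r1.
exists (r - `|z|), (M / (r - `|z|) ^+ 2); split => // h hd.
have zh1 : `|z + h| < 1.
  rewrite (le_lt_trans (ler_normD _ _))// (le_lt_trans _ r1)//.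
  by rewrite -lerBrDl.
(* Index 0 contributes nothing to [taylor1], so [N + 1] terms here match [N] terms of the derived
   series. *)
pose u N := \sum_(n < N.+1) a n * taylor1 z h n.
have ul : u @ \oo --> psum a (z + h) - psum a z - psum (dcoef a) z * h.
  rewrite (_ : u = (fun n => series (fun n => a n * (z + h) ^+ n) n.+1 -
    series (fun n => a n * z ^+ n) n.+1 -
    series (fun n => dcoef a n * z ^+ n) n * h)); last first.
    apply/funext => n; rewrite /u /series/= !big_mkord.
    rewrite -sumrB mulr_suml.
    rewrite big_ord_recl [X in _ = X - _]big_ord_recl /taylor1 /=.
    rewrite !expr0 !mul0r !subr0 !subrr mulr0 !add0r -sumrB.
    apply: eq_bigr => i _; rewrite /dcoef /bump /= add1n add0n; ring.
  apply: cvgB; first apply: cvgB.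
  - by rewrite (cvg_shiftS (series _)); exact: psumP.
  - by rewrite (cvg_shiftS (series _)); exact: psumP.
  - by apply: cvgMl; apply: psumP => //; exact: tame_dcoef.
apply: lim_norm_le ul _ => N; rewrite /u mulrAC ler_pdivlMr ?exprn_gt0//.
apply: le_trans (_ : \sum_(n < N.+1) `|a n| * r ^+ n * `|h| ^+ 2 <= _); last first.
  by rewrite -mulr_suml ler_wpM2r ?exprn_ge0.
apply: le_trans (ler_wpM2r _ (ler_norm_sum _ _ _)) _; first by rewrite exprn_ge0// ltW.
rewrite mulr_suml; apply: ler_sum => n _.
rewrite normrM -!mulrA ler_wpM2l// mulrC [leRHS]mulrC.
apply: le_trans (taylor1_le n (lexx `|z|) (ltW d0) hd) _.
rewrite ler_wpM2l ?exprn_ge0//.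
by apply: le_trans (taylor1_le_exp n (normr_ge0 z) (ltW d0)) _; rewrite subrKC.
Qed.

Lemma is_derive_psum a z : tame a -> `|z| < 1 ->
  is_derive z (1 : C) (psum a) (psum (dcoef a) z).
Proof.
move=> ta z1; apply/is_derive_epsP => e e0.
have [d [M [d0 HM]]] := psum_taylor1 ta z1.
have M0 : 0 <= M.
  have := HM d; rewrite gtr0_norm// => /(_ (lexx _)) /(le_trans (normr_ge0 _)).
  by rewrite pmulr_lge0// exprn_gt0.
have M1 : 0 < M + 1 by rewrite ltr_wpDl.
have eM : 0 < e / (M + 1) by rewrite divr_gt0.
exists (Num.min d (e / (M + 1))) => [|h].
  by rewrite minEle; case: ifP.
(* The order on [C] is partial: the minimum is usable only once both radii are known to be real. *)
have cmp : d >=< e / (M + 1) by apply: real_comparable; exact: gtr0_real.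
rewrite (comparable_lt_min _ cmp) => /andP[/ltW hd hM].
apply: le_trans (HM _ hd) _; rewrite expr2 mulrA ler_wpM2r//.
apply: (le_trans (ler_wpM2l M0 (ltW hM))).
by rewrite mulrCA ler_piMr ?(ltW e0)// ler_pdivrMr// mul1r lerDl.
Qed.

End Derivative.

(** * Products of power series *)

Section CauchyProduct.
Variable R : realType.
Local Notation C := R[i].
Implicit Types (a b : nat -> C) (z s h r d : C).

(** [dcoef (fun=> 1)] is the sequence [n + 1], the coefficients of [(1 - z)^-2]; it dominates every
    Cauchy product of two sequences bounded by 1. *)
Lemma tame_dcoef1 : tame (dcoef (fun=> 1 : C)).
Proof. by apply: tame_dcoef; apply: (@tame_bound _ _ 1) => n; rewrite normr1. Qed.

Lemma dcoef1_ge0 n : 0 <= dcoef (fun=> 1 : C) n.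
Proof. by rewrite /dcoef mulr1. Qed.

Lemma conv_norm_le a b n :
  (forall i, (i <= n)%N -> `|a i| <= 1) -> (forall i, (i <= n)%N -> `|b i| <= 1) ->
  `|conv a b n| <= dcoef (fun=> 1) n.
Proof.
move=> a1 b1; rewrite /dcoef mulr1; apply: le_trans (ler_norm_sum _ _ _) _.
rewrite -[n.+1 in leRHS]card_ord -sum1_card natr_sum; apply: ler_sum => i _.
by rewrite normrM mulr_ile1 ?a1 ?b1 ?leq_subr// -ltnS.
Qed.

Lemma tame_conv a b : (forall n, `|a n| <= 1) -> (forall n, `|b n| <= 1) ->
  tame (conv a b).
Proof.
move=> a1 b1 s s0 s1.
have [K HK] := tame_dcoef1 s0 s1.
exists K => n; apply: le_trans (HK n); rewrite ler_wpM2r ?exprn_ge0//.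
by rewrite [leRHS]ger0_norm ?dcoef1_ge0//; exact: conv_norm_le.
Qed.

(** The product of two truncations at degree [n] differs from the truncated Cauchy product only in
    degrees from [n] to [2 n]. That block is dominated by [S (2 n) - S n], which tends to 0 since
    [S] converges. *)
Lemma psum_conv a b z :
  (forall n, `|a n| <= 1) -> (forall n, `|b n| <= 1) -> `|z| < 1 ->
  psum (conv a b) z = psum a z * psum b z.
Proof.
move=> a1 b1 z1; apply: psum_unique.
pose A := series (fun n => a n * z ^+ n); pose B := series (fun n => b n * z ^+ n).
have AB : (fun n => A n * B n) @ \oo --> psum a z * psum b z.
  by apply: cvgM; apply: psumP => //; apply: tame_bound.
pose U := series (fun n => conv a b n * z ^+ n).
suff UAB : (U - (fun n => A n * B n)) @ \oo --> (0 : C).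
  exact: (cvg_sub0 UAB AB).
pose S := series (fun n => dcoef (fun=> 1 : C) n * `|z| ^+ n).
have Sl : S @ \oo --> psum (dcoef (fun=> 1)) `|z|.
  by apply: psumP; [exact: tame_dcoef1|rewrite normr_id].
have S2l : (fun n => S n.*2) @ \oo --> psum (dcoef (fun=> 1)) `|z|.
  apply: (@cvg_comp _ _ _ (fun n => n.*2) S _ \oo) Sl.
  move=> E [N _ HN]; exists N => // n /= Nn; apply: HN => /=.
  by rewrite -addnn (leq_trans Nn)// leq_addr.
have : ((fun n => S n.*2) - S) @ \oo -->
    psum (dcoef (fun=> 1)) `|z| - psum (dcoef (fun=> 1)) `|z|.
  by apply: cvgB; [exact: S2l|exact: Sl].
rewrite subrr => /cvgrPdist_le H; apply/cvgrPdist_le => e /H; apply: filterS => n.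
rewrite !sub0r !normrN => /(le_trans _); apply.
pose p := \poly_(i < n) a i; pose q := \poly_(i < n) b i.
have pE : A n = p.[z] by rewrite horner_poly /A /series/= big_mkord.
have qE : B n = q.[z] by rewrite horner_poly /B /series/= big_mkord.
have cE i : (p * q)`_i = \sum_(j < i.+1) p`_j * q`_(i - j) by rewrite coefM.
have ci i : `|(p * q)`_i| <= dcoef (fun=> 1) i.
  apply: le_trans (_ : `|conv (fun i => p`_i) (fun i => q`_i) i| <= _).
    by rewrite cE.
  by apply: conv_norm_le => j _; rewrite coef_poly; case: ifP => //; rewrite normr0.
have nn : (n <= n.*2)%N by rewrite -addnn leq_addr.
have sz : (size (p * q)%R <= n.*2)%N.
  apply: leq_trans (size_polyMleq _ _) _; rewrite -addnn.
  by apply: leq_trans (leq_pred _) _; rewrite leq_add// size_poly.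
have -> : (U - (fun n => A n * B n)) n =
    - \sum_(n <= i < n.*2) (p * q)`_i * z ^+ i.
  transitivity (U n - p.[z] * q.[z]); first by rewrite -pE -qE.
  rewrite -hornerM (horner_coef_wide _ sz).
  rewrite -(big_mkord xpredT (fun i => (p * q)`_i * z ^+ i)).
  rewrite (big_cat_nat (leq0n n) nn) /U /series /= opprD addrA.
  rewrite [X in X + _](_ : _ = 0) ?add0r//; apply/eqP; rewrite subr_eq0; apply/eqP.
  apply: eq_big_nat => i /= ni; rewrite coefM /conv; congr (_ * _).
  apply: eq_bigr => j _; rewrite !coef_poly (leq_ltn_trans (leq_subr _ _) ni).
  by rewrite (leq_ltn_trans _ ni)// -ltnS.
have -> : ((fun n => S n.*2) - S) n =
    \sum_(n <= i < n.*2) dcoef (fun=> 1) i * `|z| ^+ i.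
  by rewrite fctE /S /series/= (big_cat_nat (leq0n n) nn)/= addrC addKr.
rewrite normrN; apply: le_trans (ler_norm_sum _ _ _) _.
rewrite [leRHS]ger0_norm; last first.
  by apply: sumr_ge0 => i _; rewrite mulr_ge0 ?dcoef1_ge0 ?exprn_ge0.
by apply: ler_sum => i _; rewrite normrM normrX ler_wpM2r ?exprn_ge0.
Qed.
End CauchyProduct.

(** * Complex differentiation and a mean value theorem *)

Section Calculus.
Variable R : realType.
Local Notation C := R[i].
Implicit Types (F G : C -> C) (z v u l k : C).

Lemma is_deriveCM F G z k l : is_derive z (1 : C) F k -> is_derive z (1 : C) G l ->
  is_derive z (1 : C) (fun z => F z * G z) (k * G z + F z * l).
Proof.
move=> dF dG; suff -> : k * G z + F z * l = F z *: l + G z *: k.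
  exact: is_deriveM.
by rewrite addrC [k * _]mulrC.
Qed.

Lemma is_deriveC_eq F z k l : is_derive z (1 : C) F k -> k = l ->
  is_derive z (1 : C) F l.
Proof. by move=> ? <-. Qed.

Lemma is_deriveCD F G z k l : is_derive z (1 : C) F k -> is_derive z (1 : C) G l ->
  is_derive z (1 : C) (fun z => F z + G z) (k + l).
Proof. exact: is_deriveD. Qed.

Lemma is_deriveCB F G z k l : is_derive z (1 : C) F k -> is_derive z (1 : C) G l ->
  is_derive z (1 : C) (fun z => F z - G z) (k - l).
Proof. exact: is_deriveB. Qed.

Lemma is_derive_line F z v u (t : R) l : is_derive (z + t%:C * v) (1 : C) F l ->
  is_derive t (1 : R) (fun t : R => complex.Re (u * F (z + t%:C * v)))
    (complex.Re (u * l * v)).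
Proof.
move/is_derive_epsP => H; apply/is_derive_epsP => e e0.
pose m := Normc.normc u * Normc.normc v.
have m0 : 0 <= m by rewrite mulr_ge0// /Normc.normc; case: (u) (v) => ? ? [? ?]; rewrite sqrtr_ge0.
(* Adding 1 keeps the divisor positive even if [u] or [v] is zero. *)
have m1 : 0 < m + 1 by rewrite ltr_wpDl.
have em : 0 < (e / (m + 1))%:C by rewrite ltcR divr_gt0.
have [d d0 Hd] := H _ em.
have dE : d = (complex.Re d)%:C by rewrite -[LHS]RRe_real// realE ltW.
have d0' : 0 < complex.Re d by rewrite -ltcR -dE.
exists (complex.Re d / (Normc.normc v + 1)) => [|h hd].
  rewrite divr_gt0// ltr_wpDl// /Normc.normc; case: (v) => ? ?; rewrite sqrtr_ge0//.
have v0 : 0 <= Normc.normc v by rewrite /Normc.normc; case: (v) => ? ?; rewrite sqrtr_ge0.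
have nE (w : C) : `|w| = (Normc.normc w)%:C by [].
have hR : `|h%:C : C| = (`|h|)%:C by rewrite normc_def /= expr0n addr0 sqrtr_sqr.
have hv : `|h%:C * v| < d.
  rewrite normrM hR nE dE -rmorphM ltcR; move: hd; rewrite ltr_pdivlMr ?ltr_wpDl//.
  by apply: le_lt_trans; rewrite ler_wpM2l// lerDl.
have {Hd hv} Hd := Hd _ hv.
rewrite -lecR -(_ : z + t%:C * v + h%:C * v = z + (t + h)%:C * v) in Hd *; last first.
  by rewrite rmorphD/=; ring.
set A := F (_ + h%:C * v); set B := F (z + _).
have -> : complex.Re (u * A) - complex.Re (u * B) - complex.Re (u * l * v) * h =
   complex.Re (u * (A - B - l * (h%:C * v))).
  rewrite !mulrBr !raddfB/=; congr (_ - _).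
  by case: (u) (l) (v) => ? ? [? ?] [? ?] /=; ring.
apply: le_trans (normc_ge_Re _) _; rewrite normrM.
apply: le_trans (ler_wpM2l (normr_ge0 _) Hd) _.
rewrite normrM hR !nE -!rmorphM lecR.
have -> : Normc.normc u * (e / (m + 1) * (`|h| * Normc.normc v)) =
   e * `|h| * (m / (m + 1)) by rewrite /m; ring.
by rewrite ler_piMr ?mulr_ge0 ?(ltW e0)// ler_pdivrMr// mul1r lerDl.
Qed.

Lemma inD_line z v (t : R) : inD z -> inD (z + v) -> 0 <= t <= 1 ->
  inD (z + t%:C * v).
Proof.
rewrite /inD => z1 v1 /andP[t0 t1].
have -> : z + t%:C * v = (1 - t)%:C * z + t%:C * (z + v).
  by rewrite rmorphB/=; ring.
have nR (s : R) : 0 <= s -> `|s%:C : C| = s%:C by move=> s0; rewrite ger0_norm// lecR.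
apply: le_lt_trans (ler_normD _ _) _; rewrite !normrM !nR ?subr_ge0//.
have [->|tn0] := eqVneq t 0; first by rewrite subr0 mul1r mul0r addr0.
have -> : 1 = (1 - t)%:C + t%:C :> C by rewrite rmorphB/= subrK.
rewrite ler_ltD// ?ler_piMr ?(ltW z1) ?lecR ?subr_ge0//.
by rewrite gtr_pMr// ltcR lt_neqAle eq_sym tn0.
Qed.

(** The mean value theorem fails for complex values but holds for every real projection [Re (u F)].
    The choices [u = 1] and [u = - 'i] recover both parts of an increment; [u] the conjugate of [v]
    turns [F' c * v] into [|v|^2 F' c], which serves for univalence. *)
Lemma complex_MVT F F' z v u :
  (forall z, inD z -> is_derive z (1 : C) F (F' z)) -> inD z -> inD (z + v) ->
  exists2 c, inD c & complex.Re (u * (F (z + v) - F z)) = complex.Re (u * F' c * v).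
Proof.
move=> dF z1 v1.
pose f (t : R) := complex.Re (u * F (z + t%:C * v)).
have df (t : R) : 0 <= t <= 1 ->
    is_derive t (1 : R) f (complex.Re (u * F' (z + t%:C * v) * v)).
  by move=> t01; apply: is_derive_line; apply: dF; exact: inD_line.
have [|||c c01 H] := @derive.MVT_segment R f (fun t => complex.Re (u * F' (z + t%:C * v) * v)) 0 1 => //.
- by move=> t /[!in_itv]/= /andP[t0 t1]; apply: df; rewrite !ltW.
- apply: derivable_within_continuous => t /[!in_itv]/= t01.
  by have [] := df t t01.
exists (z + c%:C * v); first by apply: inD_line => //; move: c01; rewrite in_itv.
move: H; rewrite subr0 mulr1 /f rmorph1 mul1r rmorph0 mul0r addr0 => <-.
by rewrite mulrBr raddfB.
Qed.

Lemma inD0 : inD (0 : C). Proof. by rewrite /inD normr0. Qed.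

Lemma derive0_cst F : (forall z, inD z -> is_derive z (1 : C) F 0) ->
  forall z, inD z -> F z = F 0.
Proof.
move=> dF z z1; apply/eqP; rewrite -subr_eq0; apply/eqP.
have H u : complex.Re (u * (F z - F 0)) = 0.
  have [|c c1] := @complex_MVT F (fun=> 0) 0 z u dF inD0; first by rewrite add0r.
  by rewrite add0r => ->; rewrite mulr0 mul0r.
move: (H 1) (H (- 'i)); case: (F z - F 0) => x y /=.
by rewrite mul1r mul0r subr0 oppr0 mul0r sub0r mulNr mul1r opprK => -> ->.
Qed.
End Calculus.

(** * Power series solutions of differential equations *)

Section ODE.
Variable R : realType.
Local Notation C := R[i].

(** Course-of-values recursion: [F n] may look at all entries up to [n], so the values are
    accumulated in lists. *)
Lemma rec_seq (T : Type) (c : T) (F : nat -> (nat -> T) -> T) :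
  (forall n a b, (forall i, (i <= n)%N -> a i = b i) -> F n a = F n b) ->
  exists a, a 0%N = c /\ forall n, a n.+1 = F n a.
Proof.
move=> Fext.
(* [g n] lists the values of index at most [n]; the default [c] of [nth] is never read in a relevant
   place, by the hypothesis on [F]. *)
pose fix g n := if n is m.+1 then rcons (g m) (F m (nth c (g m))) else [:: c].
have sg n : size (g n) = n.+1 by elim: n => //= n IH; rewrite size_rcons IH.
have gE n i : (i <= n)%N -> nth c (g n) i = nth c (g i) i.
  elim: n => [|n IH]; first by rewrite leqn0 => /eqP ->.
  rewrite leq_eqVlt => /predU1P[->//|]; rewrite ltnS => ni.
  by rewrite /= nth_rcons sg ltnS ni IH.
exists (fun n => nth c (g n) n); split => // n.
rewrite [LHS]/= nth_rcons sg ltnn eqxx; apply: Fext => i ni; exact: gE.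
Qed.

(* [(n+1) y_(n+1)] is a sum of [n+1] products of coefficients bounded by 1. *)
Lemma linear_ode (p : nat -> C) : (forall n, `|p n| <= 1) ->
  exists y : nat -> C, [/\ y 0%N = 1, forall n, `|y n| <= 1 & dcoef y = conv p y].
Proof.
move=> p1.
have [|y [y0 yS]] := @rec_seq C 1 (fun n y => conv p y n / n.+1%:R).
  move=> n a b ab; congr (_ / _); apply: eq_bigr => i _.
  by rewrite ab// leq_subr.
exists y; split => //.
  elim/ltn_ind => -[|n] IH; first by rewrite y0 normr1.
  rewrite yS normrM normfV normr_nat ler_pdivrMr ?ltr0n// mul1r.
  have IH' i : (i <= n)%N -> `|y i| <= 1 by move=> ni; exact: IH.
  by have := conv_norm_le (fun i _ => p1 i) IH'; rewrite /dcoef mulr1.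
by apply/funext => n; rewrite /dcoef yS mulrC divfK// pnatr_eq0.
Qed.

(** This is [T' = 1 - T^2] on coefficients. The constant 1 enters only at index 0, where [conv t t]
    vanishes because [t 0 = 0], so the bound 1 survives the induction. *)
Lemma tanh_coef : exists t : nat -> C,
  [/\ t 0%N = 0, forall n, `|t n| <= 1 &
      dcoef t = (fun n => (if n == 0%N then 1 else 0) + - 1 * conv t t n)].
Proof.
have [|t [t0 tS]] :=
    @rec_seq C 0 (fun n t => ((if n == 0%N then 1 else 0) + - 1 * conv t t n) / n.+1%:R).
  move=> n a b ab; congr ((_ + - 1 * _) / _); apply: eq_bigr => i _.
  by rewrite !ab ?leq_subr// -ltnS.
exists t; split => //.
  elim/ltn_ind => -[|n] IH; first by rewrite t0 normr0.
  rewrite tS normrM normfV normr_nat ler_pdivrMr ?ltr0n// mul1r.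
  case: n IH => [|n] IH; rewrite ?eqxx /=.
    by rewrite /conv big_ord1 t0 mul0r mulr0 addr0 normr1.
  rewrite add0r mulN1r normrN.
  have IH' i : (i <= n.+1)%N -> `|t i| <= 1 by move=> ni; exact: IH.
  by have := conv_norm_le IH' IH'; rewrite /dcoef mulr1.
by apply/funext => n; rewrite /dcoef tS mulrC divfK// pnatr_eq0.
Qed.

Lemma linear_ode_sol (p y : nat -> C) : (forall n, `|p n| <= 1) ->
  (forall n, `|y n| <= 1) -> dcoef y = conv p y ->
  forall z, inD z -> is_derive z (1 : C) (psum y) (psum p z * psum y z).
Proof.
move=> p1 y1 yE z z1; rewrite -psum_conv// -yE.
by apply: is_derive_psum => //; exact: tame_bound.
Qed.

(* If [G' = 2 p G] and [W' = - p W] then [W^2 G] is constant. *)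
Lemma linear_ode_unique (p : nat -> C) (G : C -> C) : (forall n, `|p n| <= 1) ->
  (forall z, inD z -> is_derive z (1 : C) G (2 * psum p z * G z)) ->
  G 0 = 0 -> forall z, inD z -> G z = 0.
Proof.
move=> p1 dG G0.
have [y [y0 y1 yE]] := linear_ode p1.
have q1 n : `|-1 * p n| <= 1 by rewrite mulN1r normrN.
have [w [w0 w1 wE]] := linear_ode q1.
have dY := linear_ode_sol p1 y1 yE; have dW := linear_ode_sol q1 w1 wE.
have qE z : inD z -> psum (fun n => - 1 * p n) z = - psum p z.
  by move=> z1; rewrite psumZ ?mulN1r//; exact: tame_bound p1.
(* [Y W] has derivative 0, hence stays 1, so [W] has no zero and can be cancelled from
   [W^2 G = 0]. *)
have YW z : inD z -> psum y z * psum w z = 1.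
  move=> z1; transitivity (psum y 0 * psum w 0); last by rewrite !psum0 y0 w0 mulr1.
  apply: (@derive0_cst _ (fun z => psum y z * psum w z)) => // x x1.
  apply: is_deriveC_eq (is_deriveCM (dY x x1) (dW x x1)) _.
  by rewrite qE//; ring.
move=> z z1.
have : psum w z * psum w z * G z = 0.
  transitivity (psum w 0 * psum w 0 * G 0); last by rewrite G0 mulr0.
  apply: (@derive0_cst _ (fun z => psum w z * psum w z * G z)) => // x x1.
  apply: is_deriveC_eq (is_deriveCM (is_deriveCM (dW x x1) (dW x x1)) (dG x x1)) _.
  by rewrite qE//; ring.
move=> /eqP; rewrite !mulf_eq0 orbb => /orP[/eqP wz0|/eqP//].
by have := YW z z1; rewrite wz0 mulr0 => /eqP; rewrite eq_sym oner_eq0.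
Qed.
End ODE.

(** * The complex exponential and its derivative *)

Section ComplexExponential.
Variable R : realType.
Local Notation C := R[i].
Implicit Types (z h k : C).

Lemma expC0 : expC 0 = 1 :> C.
Proof. by rewrite /expC /= expR0 cos0 sin0 mul1r. Qed.

Lemma expCD z h : expC (z + h) = expC z * expC h.
Proof.
case: z h => [x y] [a b]; rewrite /expC /= expRD cosD sinD; apply/eqP.
by rewrite eq_complex /=; apply/andP; split; apply/eqP; ring.
Qed.

(** Only the behaviour at the origin is needed: the functional equation of [expC] carries it to
    every other point. *)
Lemma expC_taylor1_real (e : R) : 0 < e -> exists2 d : R, 0 < d &
  forall a b : R, `|a| < d -> `|b| < d ->
  `|expR a * cos b - 1 - a| + `|expR a * sin b - b| <= e * (`|a| + `|b|).
Proof.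
(* With [|a| < f <= 1] the four errors below add up to at most [f |a| + 8 f |b|], which [9 f <= e]
   covers. *)
move=> e0; have [f [f0 f1 fe]] : exists f, [/\ 0 < f, f <= 1 & 9 * f <= e].
  exists (Num.min 1 (e / 9)); split; first by rewrite lt_min ltr01 divr_gt0.
    by rewrite ge_min lexx.
  by rewrite mulrC -ler_pdivlMr// ge_min lexx orbT.
have /is_derive_epsP /(_ f f0)[d1 d10 H1] := is_derive_expR (0 : R).
have /is_derive_epsP /(_ f f0)[d2 d20 H2] := is_derive_cos (0 : R).
have /is_derive_epsP /(_ f f0)[d3 d30 H3] := is_derive_sin (0 : R).
exists (Num.min f (Num.min d1 (Num.min d2 d3))); first by rewrite !lt_min f0 d10 d20 d30.
move=> a b; rewrite !lt_min => /and4P[af ad1 _ _] /and4P[bf _ bd2 bd3].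
have := H1 a ad1; have := H2 b bd2; have := H3 b bd3.
rewrite !add0r sin0 cos0 expR0 oppr0 mul0r !mul1r !(subr0, addr0) => hs hc he.
have a0 := normr_ge0 a; have b0 := normr_ge0 b.
have ea1 : `|expR a - 1| <= 2 * `|a|.
  rewrite -[expR a - 1](subrK a) (le_trans (ler_normD _ _))//.
  by rewrite mulr_natl mulr2n lerD// (le_trans he)// ler_piMl.
have ea : `|expR a| <= 3.
  rewrite -[expR a](subrK 1) (le_trans (ler_normD _ _))// normr1.
  by rewrite (_ : 3 = 2 + 1) ?lerD2r ?(le_trans ea1)//; lra.
have -> : expR a * cos b - 1 - a = (expR a - 1 - a) + expR a * (cos b - 1) by ring.
have -> : expR a * sin b - b = expR a * (sin b - b) + (expR a - 1) * b by ring.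
apply: le_trans (lerD (ler_normD _ _) (ler_normD _ _)) _; rewrite !normrM.
have h1 : `|expR a| * `|cos b - 1| <= 3 * (f * `|b|) by rewrite ler_pM.
have h2 : `|expR a| * `|sin b - b| <= 3 * (f * `|b|) by rewrite ler_pM.
have h3 : `|expR a - 1| * `|b| <= 2 * f * `|b|.
  by rewrite ler_wpM2r// (le_trans ea1)// ler_wpM2l// ltW.
have h4 : 9 * f * (`|a| + `|b|) <= e * (`|a| + `|b|) by apply: ler_wpM2r fe; rewrite addr_ge0.
have h5 : 0 <= f * `|a| by rewrite mulr_ge0// ltW.
have h6 : 0 <= f * `|b| by rewrite mulr_ge0// ltW.
lra.
Qed.

Lemma expC_taylor1 (e : C) : 0 < e -> exists2 d : C, 0 < d &
  forall h, `|h| < d -> `|expC h - 1 - h| <= e * `|h|.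
Proof.
rewrite ltcE/= => /andP[/eqP ie re].
have eE : e = (complex.Re e)%:C by case: e ie {re} => x y /= ->.
have [|d d0 H] := @expC_taylor1_real (complex.Re e / 2); first by rewrite divr_gt0.
exists d%:C; first by rewrite ltcR.
move=> h hd.
have ha : (`|complex.Re h|)%:C <= `|h| := normc_ge_Re h.
have hb : (`|complex.Im h|)%:C <= `|h| := norm_Im_le h.
have had := le_lt_trans ha hd; have hbd := le_lt_trans hb hd.
rewrite !ltcR in had hbd.
apply: le_trans (norm_le_ReIm _) _.
apply: (@le_trans _ _ (complex.Re e / 2 * (`|complex.Re h| + `|complex.Im h|))%:C).
  have -> : complex.Re (expC h - 1 - h) =
      expR (complex.Re h) * cos (complex.Im h) - 1 - complex.Re h.
    by case: (h) => x y /=; ring.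
  have -> : complex.Im (expC h - 1 - h) =
      expR (complex.Re h) * sin (complex.Im h) - complex.Im h.
    by case: (h) => x y /=; ring.
  by rewrite lecR H.
rewrite rmorphM rmorphD rmorphM /= -eE fmorphV rmorph_nat -mulrA.
have e0 : 0 <= e by rewrite eE lecR ltW.
by rewrite ler_wpM2l// ler_pdivrMl// mulr_natl mulr2n lerD.
Qed.

Lemma is_derive_expC k z :
  is_derive z (1 : C) (fun z => expC (k * z)) (k * expC (k * z)).
Proof.
apply/is_derive_epsP => e e0.
pose m := `|expC (k * z)| * `|k|.
have m0 : 0 <= m by rewrite mulr_ge0.
have m1 : 0 < m + 1 by rewrite ltr_wpDl.
have k1 : 0 < `|k| + 1 by rewrite ltr_wpDl.
have em : 0 < e / (m + 1) by rewrite divr_gt0.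
have [d d0 Hd] := expC_taylor1 em.
exists (d / (`|k| + 1)) => [|h hd]; first by rewrite divr_gt0.
have kh : `|k * h| < d.
  rewrite normrM; move: hd; rewrite ltr_pdivlMr//; apply: le_lt_trans.
  by rewrite mulrC ler_wpM2l// lerDl.
have -> : expC (k * (z + h)) - expC (k * z) - k * expC (k * z) * h =
    expC (k * z) * (expC (k * h) - 1 - k * h) by rewrite mulrDr expCD; ring.
rewrite (normrM (expC _)); apply: le_trans (ler_wpM2l (normr_ge0 _) (Hd _ kh)) _.
rewrite (normrM k) [leLHS](_ : _ = e * `|h| * (m / (m + 1))); last by rewrite /m; ring.
by rewrite ler_piMr ?mulr_ge0 ?(ltW e0)// ler_pdivrMr// mul1r lerDl.
Qed.
End ComplexExponential.

(** * The series of [tanh] and of the principal root *)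

Section SquareRootOfTanh.
Variable R : realType.
Local Notation C := R[i].

Lemma is_deriveC_cst (k z : C) : is_derive z (1 : C) (fun=> k) 0.
Proof. exact: is_derive_cst. Qed.

Lemma sqrtc_Re_ge0 (z : C) : 0 <= complex.Re (sqrtc z).
Proof. by case: z => a b /=; exact: sqrtr_ge0. Qed.

Lemma sqrtc_sqr (z : C) : 0 < complex.Re z -> sqrtc (z ^+ 2) = z.
Proof.
move=> z0; have /eqP := sqr_sqrtc (z ^+ 2); rewrite eqf_sqr => /orP[/eqP//|/eqP E].
by have := sqrtc_Re_ge0 (z ^+ 2); rewrite E raddfN oppr_ge0 leNgt z0.
Qed.

(** For [z = a + i b] one has [|b| < 1 <= pi / 2], so [cos b > 0]; a real value forces
    [sin (2 b) = 0], hence [sin b = 0], and the value is then positive. The case [x = -1] says that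
    the denominator of [tanhC] does not vanish. *)
Lemma expC_double_neq_neg (z : C) (x : R) : inD z -> x <= 0 -> expC (2 * z) != x%:C.
Proof.
case: z => a b; rewrite /inD => z1 x0; apply/eqP.
have b1 : `|b| < 1 by rewrite -ltcR; apply: le_lt_trans z1; exact: (norm_Im_le (a +i* b)).
have cb : 0 < cos b.
  apply: cos_gt0_pihalf; move: b1; rewrite ltr_norml => /andP[h1 h2].
  have := @pihalf_ge1 R; lra.
have -> : 2 * (a +i* b) = (a *+ 2) +i* (b *+ 2) by rewrite mulr_natl !mulr2n.
rewrite /expC /= => -[].
rewrite !mul0r subr0 addr0 sin_mulr2n cos_mulr2n => hc /eqP.
rewrite mulf_eq0 gt_eqF ?expR_gt0//= mulrn_eq0 /= mulf_eq0 gt_eqF//= => /eqP sb.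
have := cos2Dsin2 b; rewrite sb expr0n addr0 => cb1.
by move: hc; rewrite cb1 mulr2n addrK mulr1 => E; have := expR_gt0 (a *+ 2); lra.
Qed.

Lemma tanh_series : exists t : nat -> C, [/\ [/\ t 0%N = 0, t 1%N = 1 & t 2%N = 0],
  forall n, `|t n| <= 1,
  forall z, inD z -> is_derive z (1 : C) (psum t) (1 - psum t z ^+ 2) &
  forall z, inD z -> psum t z = tanhC z].
Proof.
have [t [t0 t1 tE]] := tanh_coef R; exists t.
have t_1 : t 1%N = 1.
  have := congr1 (fun f => f 0%N) tE.
  by rewrite /dcoef /conv big_ord1 t0 mul0r mulr0 addr0 /= mul1r.
have t_2 : t 2%N = 0.
  have := congr1 (fun f => f 1%N) tE.
  rewrite /dcoef /conv !big_ord_recl big_ord0 /= subn0 subnn t0 mul0r mulr0 !addr0 mulr0.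
  by rewrite addr0 => /eqP; rewrite mulf_eq0 pnatr_eq0 => /eqP.
have tt : tame t := tame_bound t1.
have dT z : inD z -> is_derive z (1 : C) (psum t) (1 - psum t z ^+ 2).
  move=> z1; have := is_derive_psum tt z1; rewrite tE psumD//.
  - by rewrite psumZ ?psum_cst ?psum_conv// ?mulN1r//; exact: tame_conv.
  - by apply: (@tame_bound _ _ 1) => -[|n]; rewrite ?normr1 ?normr0.
  - by apply: tameZ; exact: tame_conv.
split => // z z1.
(* Here [2 p = - (1 + T)], and [G] below satisfies [G' = 2 p G] by [T' = 1 - T^2]. Its vanishing
   reads [exp (2 z) (1 - T) = 1 + T], which is solved for [T]. The factor [1/2] keeps the
   coefficients of [p] bounded by 1. *)
pose p (n : nat) := - (1 / 2) * ((if n == 0%N then 1 else 0) + t n) : C.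
have tame1 : tame (fun n : nat => if n == 0%N then 1 else 0 : C).
  by apply: (@tame_bound _ _ 1) => -[|n]; rewrite ?normr1 ?normr0.
have p1 n : `|p n| <= 1.
  rewrite /p normrM normrN normrM normr1 normfV normr_nat mul1r ler_pdivrMl// mulr1.
  apply: le_trans (ler_normD _ _) _; rewrite (_ : 2 = 1 + 1)// lerD//.
  by case: n => [|n]; rewrite ?normr1 ?normr0.
have pE x : inD x -> 2 * psum p x = - (1 + psum t x).
  move=> x1; rewrite psumZ ?psumD ?psum_cst//; last exact: tameD.
  by field.
pose G x := (1 - psum t x) - expC (-2 * x) * (1 + psum t x).
have dG x : inD x -> is_derive x (1 : C) G (2 * psum p x * G x).
  move=> x1; rewrite pE//.
  have d1 := is_deriveC_cst 1 x.
  apply: is_deriveC_eq (is_deriveCB (is_deriveCB d1 (dT x x1))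
    (is_deriveCM (is_derive_expC (-2) x) (is_deriveCD d1 (dT x x1)))) _.
  by rewrite /G; ring.
have G0 : G 0 = 0 by rewrite /G psum0 t0 mulr0 expC0; ring.
have := linear_ode_unique p1 dG G0 z1; rewrite /G /tanhC => /eqP; rewrite subr_eq0 => /eqP E.
have eE : expC (2 * z) * expC (-2 * z) = 1.
  by rewrite -expCD -mulrDl subrr mul0r expC0.
have : expC (2 * z) * (1 - psum t z) = 1 + psum t z by rewrite E mulrA eE mul1r.
move=> H; have e1 : expC (2 * z) + 1 != 0.
  by rewrite addr_eq0; have := expC_double_neq_neg z1 (lerN10 R); rewrite rmorphN1.
apply: (mulIf e1); rewrite divfK//.
have -> : psum t z * (expC (2 * z) + 1) =
  expC (2 * z) - (expC (2 * z) * (1 - psum t z)) + psum t z by ring.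
by rewrite H; ring.
Qed.

Lemma Bfun_series : exists b : nat -> C, [/\
  [/\ b 0%N = 1, b 1%N = 1 / 2, b 2%N = - (1 / 8) & b 3%N = - (5 / 48)],
  forall n, `|b n| <= 1, forall z, inD z -> psum b z = Bfun z &
  forall z, inD z -> 0 < complex.Re (psum b z)].
Proof.
have [t [[t0 t_1 t_2] t1 dT tT]] := tanh_series.
have tt : tame t := tame_bound t1.
pose p (n : nat) := (1 / 2) * ((if n == 0%N then 1 else 0) + (-1) * t n) : C.
have tame1 : tame (fun n : nat => if n == 0%N then 1 else 0 : C).
  by apply: (@tame_bound _ _ 1) => -[|n]; rewrite ?normr1 ?normr0.
have p1 n : `|p n| <= 1.
  rewrite /p normrM normrM normr1 normfV normr_nat mul1r ler_pdivrMl// mulr1.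
  apply: le_trans (ler_normD _ _) _; rewrite (_ : 2 = 1 + 1)// lerD//.
    by case: n => [|n]; rewrite ?normr1 ?normr0.
  by rewrite mulN1r normrN.
have pE x : inD x -> 2 * psum p x = 1 - psum t x.
  move=> x1; rewrite psumZ ?psumD ?psum_cst ?psumZ//; first by field.
  - exact: tameZ.
  - by apply: tameD => //; exact: tameZ.
have [b [b0 b1 bE]] := linear_ode p1.
have dB := linear_ode_sol p1 b1 bE.
have sqB x : inD x -> psum b x ^+ 2 = 1 + psum t x.
  move=> x1; apply/eqP; rewrite -subr_eq0; apply/eqP.
  (* The difference of [Y^2] and [1 + T] solves [G' = 2 p G] with [2 p = 1 - T], and vanishes at
     0. *)
  apply: (@linear_ode_unique _ p (fun x => psum b x ^+ 2 - (1 + psum t x))) x1 => //.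
    move=> z z1; have d1 := is_deriveC_cst 1 z.
    apply: is_deriveC_eq (is_deriveCB (is_deriveCM (dB z z1) (dB z z1))
      (is_deriveCD d1 (dT z z1))) _.
    have -> : psum t z = 1 - 2 * psum p z by rewrite pE//; ring.
    by ring.
  by rewrite !psum0 b0 t0; ring.
exists b.
(* If [Y = i y] then [exp (2 z) = - y^2 / (2 + y^2)], impossible as [|Im (2 z)| < pi]. *)
have Re_neq0 z : inD z -> complex.Re (psum b z) != 0.
  move=> z1; apply/eqP => R0; pose y := complex.Im (psum b z).
  have y2 : 0 < 2 + y ^+ 2 by rewrite ltr_wpDr ?sqr_ge0.
  have x0 : - y ^+ 2 / (2 + y ^+ 2) <= 0.
    by rewrite mulNr oppr_le0 divr_ge0 ?sqr_ge0// ltW.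
  have /eqP := expC_double_neq_neg z1 x0; apply.
  have Y2 : psum b z ^+ 2 = - (y ^+ 2)%:C.
    rewrite /y; case: (psum b z) R0 => r s /= ->; apply/eqP.
    by rewrite eq_complex /=; apply/andP; split; apply/eqP; ring.
  have e1 : expC (2 * z) + 1 != 0.
    by rewrite addr_eq0; have := expC_double_neq_neg z1 (lerN10 R); rewrite rmorphN1.
  have H : - (y ^+ 2)%:C * (expC (2 * z) + 1) = 2 * expC (2 * z).
    by rewrite -Y2 sqB// tT// /tanhC mulrDl divfK//; ring.
  have y2C : (2 + y ^+ 2)%:C != 0 :> C by rewrite eq_sym; move: y2; rewrite -ltcR lt_neqAle => /andP[].
  apply: (mulIf y2C); rewrite -rmorphM divfK; last by rewrite gt_eqF.
  rewrite rmorphN rmorphD rmorph_nat /= mulrDr [_ * 2]mulrC -H.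
  by ring.
(* On the segment from 0, where [Y = 1], to [z] the real part cannot change sign without
   vanishing. *)
have Re_gt0 z : inD z -> 0 < complex.Re (psum b z).
  move=> z1; rewrite ltNge; apply/negP => Rle0.
  pose f (s : R) := complex.Re (1 * psum b (0 + s%:C * z)).
  have inDt s : 0 <= s <= 1 -> inD (0 + s%:C * z).
    by move=> s01; apply: inD_line s01; rewrite ?add0r//; exact: inD0.
  have cf : {within `[0, 1], continuous f}.
    apply: derivable_within_continuous => x /[!in_itv]/= x01.
    by have [] := @is_derive_line _ (psum b) 0 z 1 x _ (dB _ (inDt x x01)).
  have f0 : f 0 = 1 by rewrite /f mul0r addr0 psum0 b0 mul1r.
  have f1 : f 1 = complex.Re (psum b z) by rewrite /f !mul1r add0r.
  have [||c] := @IVT R f 0 1 0 _ cf; first exact: ler01.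
    by rewrite f0 f1 ge_min Rle0 orbT le_max ler01.
  rewrite in_itv /= => c01 fc.
  by have := Re_neq0 _ (inDt c c01); rewrite -[psum b _]mul1r -/(f c) fc eqxx.
split => //.
(* Since [p = 1/2 - z/2 + O(z^3)], the recurrence gives [b1 = 1/2], [2 b2 = b1/2 - 1/2] and
   [3 b3 = b2/2 - b1/2]. *)
- have E n : dcoef b n = conv p b n by rewrite bE.
  have := E 0%N; have := E 1%N; have := E 2%N.
  rewrite /dcoef /conv !big_ord_recl !big_ord0 /p /= b0 t0 t_1.
  rewrite !subn0 [(2 - bump 0 0)%N](_ : _ = 1%N)// [bump 0 (bump 0 0)](_ : _ = 2%N)// t_2.
  move=> E2 E1 E0.
  have b_1 : b 1%N = 1 / 2 by rewrite -[LHS]mul1r E0; field.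
  have b_2 : b 2%N = - (1 / 8).
    have n2 : 2 != 0 :> C by rewrite pnatr_eq0.
    by apply: (mulfI n2); rewrite E1 b_1; field.
  have b_3 : b 3%N = - (5 / 48).
    have n3 : 3 != 0 :> C by rewrite pnatr_eq0.
    by apply: (mulfI n3); rewrite E2 b_1 b_2; field.
  by split.
- by move=> z z1; rewrite /Bfun -tT// -sqB// sqrtc_sqr// Re_gt0.
Qed.
End SquareRootOfTanh.

(** * Parseval's identity over roots of unity *)

Section DiscreteParseval.
Variable F : numClosedFieldType.
Implicit Types (z : F) (a : nat -> F).

(** In characteristic 0 the polynomial [X^n - 1] is separable, so it has [n] distinct roots, and
    these form a cyclic group. *)
Lemma primitive_root_exists n : (0 < n)%N -> exists z, n.-primitive_root z.
Proof.
move=> n0; have [r rE] := closed_field_poly_normal ('X^n - 1 : {poly F}).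
rewrite (monicP (monicXnsubC 1 n0)) scale1r in rE.
have ur : uniq r.
  by rewrite -separable_prod_XsubC -rE separable_Xn_sub_1// pnatr_eq0 -lt0n.
have sr : size r = n.
  by apply/eq_add_S; rewrite -(size_prod_XsubC r id) -rE size_XnsubC.
have r1 : all n.-unity_root r by apply/allP => z zr; rewrite /root_of_unity rE root_prod_XsubC.
by have /hasP[z _ zn] := has_prim_root n0 r1 ur (eq_leq (esym sr)); exists z.
Qed.

Lemma primitive_root_norm n z : n.-primitive_root z -> `|z| = 1.
Proof.
move=> zn; have n0 := prim_order_gt0 zn; apply/eqP.
by rewrite -(@pexpr_eq1 _ `|z| n)// -normrX prim_expr_order// normr1.
Qed.

(** Expanding the squares leaves geometric sums of the roots of unity [z^(k - l)], equal to [n] for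
    [k = l] and 0 otherwise. This finite average replaces integration over a circle. *)
Lemma discrete_Parseval n z a : n.-primitive_root z ->
  \sum_(j < n) `|\sum_(k < n) a k * (z ^+ j) ^+ k| ^+ 2 =
  n%:R * \sum_(k < n) `|a k| ^+ 2.
Proof.
move=> zn; have n0 := prim_order_gt0 zn.
have zz : z * z^* = 1 by rewrite -normCK (primitive_root_norm zn) expr1n.
have orth (k l : 'I_n) : \sum_(j < n) (z ^+ k * z^* ^+ l) ^+ j = (k == l)%:R * n%:R.
  have [->|kl] := eqVneq k l.
    rewrite -exprMn zz expr1n; under eq_bigr do rewrite expr1n.
    by rewrite sumr_const card_ord mul1r.
  rewrite mul0r; set q := z ^+ k * _.
  have q1 : q != 1.
    apply: contra_neq kl => q1; apply/val_inj.
    have : z ^+ k == z ^+ l.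
      by rewrite -[z ^+ l]mul1r -q1 mulrAC -mulrA -exprMn zz expr1n mulr1.
    by rewrite (eq_prim_root_expr zn) !modn_small// => /eqP.
  have qn : q ^+ n = 1.
    have zn' : z^* ^+ n = 1.
      transitivity (z ^+ n * z^* ^+ n); first by rewrite (prim_expr_order zn) mul1r.
      by rewrite -exprMn zz expr1n.
    rewrite /q exprMn (exprAC z) (exprAC z^*) zn' (prim_expr_order zn).
    by rewrite !expr1n mulr1.
  have /eqP := subrX1 q n; rewrite qn subrr eq_sym mulf_eq0 subr_eq0 (negPf q1).
  by move=> /eqP.
transitivity (\sum_(j < n) \sum_(k < n) \sum_(l < n)
    a k * (a l)^* * (z ^+ k * z^* ^+ l) ^+ j).
  apply: eq_bigr => j _; rewrite normCK rmorph_sum mulr_suml.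
  apply: eq_bigr => k _; rewrite mulr_sumr; apply: eq_bigr => l _.
  rewrite rmorphM !rmorphXn exprMn !(exprAC _ j).
  by rewrite mulrACA.
rewrite exchange_big mulr_sumr; apply: eq_bigr => k _ /=.
rewrite exchange_big /= (bigD1 k)//= -mulr_sumr orth eqxx mul1r.
rewrite big1 ?addr0 => [|l lk]; last by rewrite -mulr_sumr orth eq_sym (negPf lk) mul0r mulr0.
by rewrite normCK mulrC.
Qed.
End DiscreteParseval.

(** * Coefficients of functions bounded by one *)

Section CoefficientBounds.
Variable R : realType.
Local Notation C := R[i].
Implicit Types (a : nat -> C) (z r e S : C).

Lemma power_series_tame (f : C -> C) a : power_series_on_D f a -> tame a.
Proof.
move=> fa s s0 s1; have := fa s; rewrite /inD ger0_norm// => /(_ s1) H.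
have : (fun n => a n * s ^+ n) @ \oo --> (0 : C).
  by apply: cvg_series_cvg_0; apply/cvg_ex; exists (f s).
move=> /cvgrPdist_le /(_ 1 ltr01)[N _ HN].
exists (1 + \sum_(n < N) `|a n| * s ^+ n) => n.
have [nN|Nn] := ltnP n N.
  rewrite (bigD1 (Ordinal nN))//= addrCA lerDl addr_ge0// sumr_ge0// => i _.
  by rewrite mulr_ge0 ?exprn_ge0.
have := HN n Nn; rewrite /= sub0r normrN normrM normrX (ger0_norm s0) => /le_trans -> //.
by rewrite lerDl sumr_ge0// => i _; rewrite mulr_ge0 ?exprn_ge0.
Qed.

Lemma power_series_psum (f : C -> C) a : power_series_on_D f a ->
  forall z, inD z -> f z = psum a z.
Proof. by move=> fa z z1; rewrite (psum_unique (fa z z1)). Qed.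

(** [N0] has to be uniform in [z]: the points where the truncation is used are scaled [N]-th roots
    of unity, which move with [N]. *)
Lemma psum_tail a r e : tame a -> 0 <= r -> r < 1 -> 0 < e -> exists N0, forall N z,
  (N0 <= N)%N -> `|z| <= r -> `|psum a z - \sum_(n < N) a n * z ^+ n| <= e.
Proof.
move=> ta r0 r1 e0.
pose s := series (fun n => `|a n| * r ^+ n).
have tb : tame (fun n => `|a n|).
  by move=> x x0 x1; have [K HK] := ta x x0 x1; exists K => n; rewrite normr_id.
have r1' : `|r| < 1 by rewrite ger0_norm.
have sl : s @ \oo --> psum (fun n => `|a n|) r := psumP tb r1'.
have e2 : 0 < e / 2 by rewrite divr_gt0.
move/cvgrPdist_le: sl => /(_ _ e2)[N0 _ HN0]; exists N0 => N z NN0 zr.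
have z1 : `|z| < 1 := le_lt_trans zr r1.
pose u := series (fun n => a n * z ^+ n).
have ul : (fun n => u (n + N)%N - u N) @ \oo --> psum a z - \sum_(n < N) a n * z ^+ n.
  rewrite /u /series /= big_mkord; apply: cvgB; last exact: cvg_cst.
  by rewrite (cvg_shiftn N (series _)); exact: psumP.
apply: lim_norm_le ul _ => n.
have NnN : (N <= n + N)%N by rewrite leq_addl.
have -> : u (n + N)%N - u N = \sum_(N <= i < n + N) a i * z ^+ i.
  by rewrite /u /series /= (big_cat_nat (leq0n N) NnN)/= addrAC subrr add0r.
apply: (@le_trans _ _ (s (n + N)%N - s N)).
  rewrite /s /series /= (big_cat_nat (leq0n N) NnN)/= [leRHS]addrAC subrr add0r.
  apply: le_trans (ler_norm_sum _ _ _) _; apply: ler_sum => i _.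
  by rewrite normrM normrX ler_wpM2l// lerXn2r// nnegrE.
have H1 := HN0 (n + N)%N (leq_trans NN0 NnN); have H2 := HN0 N NN0.
apply: le_trans (real_ler_norm _) _.
  apply: ger0_real; rewrite /s /series /= (big_cat_nat (leq0n N) NnN)/= [leRHS]addrAC subrr add0r.
  by apply: sumr_ge0 => i _; rewrite mulr_ge0 ?exprn_ge0.
rewrite -[s (n + N)%N](subrK (psum (fun n => `|a n|) r)) -addrA.
rewrite (le_trans (ler_normD _ _))// [leRHS](splitr e) lerD//.
by rewrite distrC.
Qed.

Lemma Bernoulli_le r n : 0 <= r -> r <= 1 -> 1 - n%:R * r <= (1 - r) ^+ n.
Proof.
move=> r0 r1; elim: n => [|n IH]; first by rewrite mul0r subr0.
rewrite exprS; apply: le_trans (ler_wpM2l _ IH); last by rewrite subr_ge0.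
rewrite -natr1 -subr_ge0 [leRHS](_ : _ = n%:R * r ^+ 2); last by ring.
by rewrite mulr_ge0// exprn_ge0.
Qed.

Lemma Parseval_le_radius a r K : tame a -> (forall z, inD z -> `|psum a z| <= 1) ->
  0 <= r -> r < 1 -> \sum_(n < K) `|a n * r ^+ n| ^+ 2 <= 1.
Proof.
move=> ta a1 r0 r1; apply/ler_addgt0Pr => e e0.
have e3 : 0 < e / (3 + e) by rewrite divr_gt0// addr_gt0.
(* Chosen so that [(1 + d)^2 = 1 + d (2 + d) <= 1 + d (3 + e) = 1 + e], using [d <= 1]. *)
pose d := e / (3 + e).
have d1 : d <= 1 by rewrite ler_pdivrMr ?addr_gt0// mul1r lerDr.
have [N0 HN0] := psum_tail ta r0 r1 e3.
pose N := (maxn K N0).+1; have [z zN] := @primitive_root_exists C N (ltn0Sn _).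
have KN : (K <= N)%N by rewrite leqW// leq_maxl.
have NN0 : (N0 <= N)%N by rewrite leqW// leq_maxr.
apply: (@le_trans _ _ (\sum_(n < N) `|a n * r ^+ n| ^+ 2)).
  rewrite -!(big_mkord xpredT (fun n => `|a n * r ^+ n| ^+ 2)) (big_cat_nat (leq0n K) KN)/=.
  by rewrite lerDl sumr_ge0// => i _; rewrite exprn_ge0.
have N_gt0 : 0 < N%:R :> C by rewrite ltr0n.
rewrite -(ler_pM2l N_gt0) -(discrete_Parseval (fun n => a n * r ^+ n) zN).
have -> : N%:R * (1 + e) = \sum_(j < N) (1 + e) by rewrite sumr_const card_ord mulr_natl.
apply: ler_sum => j _.
have -> : \sum_(k < N) a k * r ^+ k * (z ^+ j) ^+ k = \sum_(k < N) a k * (r * z ^+ j) ^+ k.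
  by apply: eq_bigr => k _; rewrite exprMn mulrA.
have zr : `|r * z ^+ j| <= r.
  by rewrite normrM normrX (primitive_root_norm zN) expr1n mulr1 ger0_norm.
have P1 : `|\sum_(k < N) a k * (r * z ^+ j) ^+ k| <= 1 + d.
  rewrite -[X in `|X|](subKr (psum a (r * z ^+ j))) (le_trans (ler_normB _ _))// lerD//.
    by apply: a1; exact: le_lt_trans zr r1.
  exact: HN0.
apply: (@le_trans _ _ ((1 + d) ^+ 2)).
  by rewrite lerXn2r// nnegrE addr_ge0// ltW.
have -> : (1 + d) ^+ 2 = 1 + d * (2 + d) by ring.
rewrite lerD2l; apply: (@le_trans _ _ (d * (3 + e))).
  rewrite ler_wpM2l ?(ltW e3)// (_ : 3 + e = 2 + (1 + e)); last by ring.
  by rewrite lerD2l (le_trans d1)// lerDl ltW.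
by rewrite /d divfK// gt_eqF// addr_gt0.
Qed.

Lemma Parseval_le a K : tame a -> (forall z, inD z -> `|psum a z| <= 1) ->
  \sum_(n < K) `|a n| ^+ 2 <= 1.
Proof.
move=> ta a1; set S := \sum_(n < K) _; apply/ler_addgt0Pr => e e0.
have S0 : 0 <= S by apply: sumr_ge0 => i _; rewrite exprn_ge0.
(* The radius tends to 1 as [1 - d] with [d = e / (m + e)]: by Bernoulli, replacing [(1 - d)^(2 K)]
   by 1 costs at most [2 K d S = d m <= e]. *)
pose m := (K * 2)%:R * S.
have m0 : 0 <= m by rewrite mulr_ge0.
have me : 0 < m + e by rewrite ltr_wpDl.
have d0 : 0 < e / (m + e) by rewrite divr_gt0.
have d1 : e / (m + e) <= 1 by rewrite ler_pdivrMr// mul1r lerDr.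
set d := e / (m + e) in d0 d1 *.
have r0 : 0 <= 1 - d by rewrite subr_ge0.
have r1 : 1 - d < 1 by rewrite gtrBl.
have := Parseval_le_radius K ta a1 r0 r1.
have : (1 - d) ^+ (K * 2) * S <= \sum_(n < K) `|a n * (1 - d) ^+ n| ^+ 2.
  rewrite mulr_sumr; apply: ler_sum => n _.
  rewrite normrM exprMn mulrC ler_wpM2l ?exprn_ge0// normrX (ger0_norm r0) -exprM.
  by rewrite ler_wiXn2l ?(ltW r1)// leq_mul2r ltnW ?orbT.
move=> /le_trans H /H {}H.
have : (1 - (K * 2)%:R * d) * S <= 1.
  by apply: le_trans H; rewrite ler_wpM2r// Bernoulli_le// ltW.
rewrite mulrBl mul1r lerBlDr => /le_trans; apply; rewrite lerD2l.
rewrite (_ : _ * _ * _ = e * (m / (m + e))); last by rewrite /d /m; ring.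
by rewrite ler_piMr ?(ltW e0)// ler_pdivrMr// mul1r lerDl ltW.
Qed.
End CoefficientBounds.

(** * Comparing Taylor coefficients through bounded remainders *)

Section BoundedNearZero.
Variable R : realType.
Local Notation C := R[i].
Implicit Types (F G : C -> C) (a : nat -> C) (s K z : C).

(** This is [F = O(1)] at 0. It is stable under sums, products and the compositions needed, so
    remainders never have to be expanded in series. *)
Definition bounded_near0 F :=
  exists s K, 0 < s /\ forall z, `|z| <= s -> `|F z| <= K.

Lemma bounded_near0_cst (k : C) : bounded_near0 (fun=> k).
Proof. by exists 1, `|k|; split. Qed.

Lemma bounded_near0_id : bounded_near0 id.
Proof. by exists 1, 1; split. Qed.

Lemma bounded_near0_common F G : bounded_near0 F -> bounded_near0 G ->
  exists s K L, 0 < s /\ forall z, `|z| <= s -> `|F z| <= K /\ `|G z| <= L.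
Proof.
move=> [s [K [s0 HK]]] [r [L [r0 HL]]].
have cmp : s >=< r by apply: real_comparable; exact: gtr0_real.
exists (Num.min s r), K, L; split => [|z]; first by rewrite minEle; case: ifP.
by rewrite comparable_le_min// => /andP[zs zr]; split; [exact: HK|exact: HL].
Qed.

Lemma bounded_near0D F G : bounded_near0 F -> bounded_near0 G ->
  bounded_near0 (fun z => F z + G z).
Proof.
move=> bF bG; have [s [K [L [s0 H]]]] := bounded_near0_common bF bG.
exists s, (K + L); split => // z /H[HF HG].
by rewrite (le_trans (ler_normD _ _))// lerD.
Qed.

Lemma bounded_near0M F G : bounded_near0 F -> bounded_near0 G ->
  bounded_near0 (fun z => F z * G z).
Proof.
move=> bF bG; have [s [K [L [s0 H]]]] := bounded_near0_common bF bG.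
by exists s, (K * L); split => // z /H[HF HG]; rewrite normrM ler_pM.
Qed.

Lemma bounded_near0X F n : bounded_near0 F -> bounded_near0 (fun z => F z ^+ n).
Proof.
move=> [s [K [s0 H]]]; exists s, (K ^+ n); split => // z /H Fz.
by rewrite normrX lerXn2r// nnegrE (le_trans _ Fz).
Qed.

Lemma bounded_near0_psum a : tame a -> bounded_near0 (psum a).
Proof.
move=> ta; have h0 : 0 < 1 / 2 :> C by rewrite divr_gt0.
have h1 : 1 / 2 < 1 :> C by rewrite ltr_pdivrMr// mul1r ltr1n.
by have [M HM] := tame_psum_bounded ta (ltW h0) h1; exists (1 / 2), M.
Qed.

(** The inner function [z * G z] is small near 0, so it enters the ball where [F] is bounded. *)
Lemma bounded_near0_comp F G : bounded_near0 F -> bounded_near0 G ->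
  bounded_near0 (fun z => F (z * G z)).
Proof.
move=> [s [K [s0 HK]]] [r [L [r0 HL]]].
have L0 : 0 <= L by apply: le_trans (normr_ge0 _) (HL 0 _); rewrite normr0 ltW.
have L1 : 0 < L + 1 by rewrite ltr_wpDl.
have q0 : 0 < s / (L + 1) by rewrite divr_gt0.
have cmp : r >=< s / (L + 1) by apply: real_comparable; exact: gtr0_real.
exists (Num.min r (s / (L + 1))), K; split => [|z].
  by rewrite minEle; case: ifP.
rewrite comparable_le_min// => /andP[zr]; rewrite ler_pdivlMr// => zs.
apply: HK; rewrite normrM; apply: le_trans zs; rewrite ler_wpM2l//.
by rewrite (le_trans (HL _ zr))// lerDl.
Qed.

(** Let [z] tend to 0. The point 0 itself is excluded because the equation is used after division by
    [z]. *)
Lemma eq0_near0 (p s : C) F : 0 < s -> bounded_near0 F ->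
  (forall z, z != 0 -> `|z| <= s -> p + z * F z = 0) -> p = 0.
Proof.
move=> s0 [r [K [r0 HK]]] H; apply/eqP; rewrite -normr_le0.
have K0 : 0 <= K by apply: le_trans (normr_ge0 _) (HK 0 _); rewrite normr0 ltW.
have K1 : 0 < K + 1 by rewrite ltr_wpDl.
apply/ler_addgt0Pr => e e0; rewrite add0r.
have [d [d0 ds dr de]] : exists d : C, [/\ 0 < d, d <= s, d <= r & d <= e / (K + 1)].
  have e1 : 0 < e / (K + 1) by rewrite divr_gt0.
  have cmp1 : r >=< e / (K + 1) by apply: real_comparable; exact: gtr0_real.
  have m0 : 0 < Num.min r (e / (K + 1)) by rewrite minEle; case: ifP.
  have cmp : s >=< Num.min r (e / (K + 1)).
    by apply: real_comparable; exact: gtr0_real.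
  exists (Num.min s (Num.min r (e / (K + 1)))); split.
  - by rewrite minEle; case: ifP.
  - by rewrite comparable_ge_min// lexx.
  - by rewrite comparable_ge_min// comparable_ge_min// lexx orbT.
  - by rewrite comparable_ge_min// comparable_ge_min// lexx !orbT.
have nd : `|d| = d by rewrite gtr0_norm.
have := H d (lt0r_neq0 d0); rewrite nd => /(_ ds) /eqP.
rewrite addr_eq0 => /eqP ->; rewrite normrN normrM nd.
apply: (@le_trans _ _ (d * K)); first by rewrite ler_wpM2l ?HK ?nd// ltW.
rewrite ler_pdivlMr// in de; apply: le_trans de.
by rewrite ler_wpM2l ?ltW// ltrDl.
Qed.

Lemma coef_eq0_near0 (p0 p1 p2 p3 s : C) F : 0 < s -> bounded_near0 F ->
  (forall z, `|z| <= s -> p0 + p1 * z + p2 * z ^+ 2 + p3 * z ^+ 3 + z ^+ 4 * F z = 0) ->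
  [/\ p0 = 0, p1 = 0, p2 = 0 & p3 = 0].
Proof.
move=> s0 bF H.
have step (p : C) G : bounded_near0 G ->
    (forall z, z != 0 -> `|z| <= s -> p + z * G z = 0) ->
    p = 0 /\ (forall z, z != 0 -> `|z| <= s -> G z = 0).
  move=> bG HG; have p_0 := eq0_near0 s0 bG HG; split => // z z0 zs.
  by apply: (mulfI z0); rewrite mulr0 -(HG z z0 zs) p_0 add0r.
have b3 : bounded_near0 (fun z => p3 + z * F z).
  exact: bounded_near0D (bounded_near0_cst _) (bounded_near0M bounded_near0_id bF).
have b2 : bounded_near0 (fun z => p2 + z * (p3 + z * F z)).
  exact: bounded_near0D (bounded_near0_cst _) (bounded_near0M bounded_near0_id b3).
have b1 : bounded_near0 (fun z => p1 + z * (p2 + z * (p3 + z * F z))).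
  exact: bounded_near0D (bounded_near0_cst _) (bounded_near0M bounded_near0_id b2).
have [|h0 H1] := step p0 _ b1; first by move=> z _ zs; rewrite -(H z zs); ring.
have [h1 H2] := step p1 _ b2 H1.
have [h2 H3] := step p2 _ b3 H2.
have [h3 _] := step p3 _ bF H3.
by [].
Qed.

Lemma psum_taylor3 a z : tame a -> inD z ->
  psum a z = a 0%N + a 1%N * z + a 2%N * z ^+ 2 + a 3%N * z ^+ 3 +
             z ^+ 4 * psum (fun n => a n.+4) z.
Proof.
move=> ta z1; have t1 := tame_shift ta; have t2 := tame_shift t1.
have t3 := tame_shift t2.
rewrite (psum_shift ta z1) (psum_shift t1 z1) (psum_shift t2 z1) (psum_shift t3 z1).
by ring.
Qed.

Lemma comp_coef (d b c : nat -> C) : tame d -> tame b -> tame c -> c 0%N = 0 ->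
  (forall z, inD z -> inD (psum c z)) ->
  (forall z, inD z -> psum d z = psum b (psum c z)) ->
  [/\ d 1%N = b 1%N * c 1%N,
      d 2%N = b 1%N * c 2%N + b 2%N * c 1%N ^+ 2 &
      d 3%N = b 1%N * c 3%N + 2 * b 2%N * c 1%N * c 2%N + b 3%N * c 1%N ^+ 3].
Proof.
move=> td tb tc c0 cD dE.
have tame4 x : tame x -> tame (fun n => x n.+4).
  by move=> tx; exact: tame_shift (tame_shift (tame_shift (tame_shift tx))).
pose Om := psum (fun n => c n.+4); pose Ga := psum (fun n => b n.+4).
pose D4 := psum (fun n => d n.+4).
(* Here [psum c z = z u] with [u = c1 + z v]. [Q2] and [Q3] are what remains of [(z u)^2] and
   [(z u)^3] beyond degree 3, divided by [z^4]; [Ga (z u)] carries the tail of [b]. *)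
pose v z := c 2%N + (c 3%N * z + z ^+ 2 * Om z).
pose u z := c 1%N + z * v z.
pose Q2 z := v z ^+ 2 + 2 * c 1%N * (c 3%N + z * Om z).
pose Q3 z := 3 * c 1%N ^+ 2 * v z + (3 * c 1%N * (z * v z ^+ 2) + z ^+ 2 * v z ^+ 3).
pose F z := D4 z + - 1 * (b 1%N * Om z + (b 2%N * Q2 z + (b 3%N * Q3 z + u z ^+ 4 * Ga (z * u z)))).
have bC := bounded_near0_cst; have bI := bounded_near0_id.
have bI2 : bounded_near0 (fun z => z ^+ 2) := bounded_near0X 2 bI.
have bOm : bounded_near0 Om by apply: bounded_near0_psum; exact: tame4.
have bGa : bounded_near0 Ga by apply: bounded_near0_psum; exact: tame4.
have bD4 : bounded_near0 D4 by apply: bounded_near0_psum; exact: tame4.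
have bv : bounded_near0 v.
  apply: bounded_near0D => //; apply: bounded_near0D; first exact: bounded_near0M.
  exact: bounded_near0M.
have bu : bounded_near0 u by apply: bounded_near0D => //; exact: bounded_near0M.
have bQ2 : bounded_near0 Q2.
  apply: bounded_near0D; first exact: bounded_near0X.
  by apply: bounded_near0M => //; apply: bounded_near0D => //; exact: bounded_near0M.
have bQ3 : bounded_near0 Q3.
  apply: bounded_near0D; first exact: bounded_near0M.
  apply: bounded_near0D; last by apply: bounded_near0M => //; exact: bounded_near0X.
  by apply: bounded_near0M => //; apply: bounded_near0M => //; exact: bounded_near0X.
have bF : bounded_near0 F.
  apply: bounded_near0D => //; apply: bounded_near0M => //.
  apply: bounded_near0D; first exact: bounded_near0M.
  apply: bounded_near0D; first exact: bounded_near0M.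
  apply: bounded_near0D; first exact: bounded_near0M.
  apply: bounded_near0M; first exact: bounded_near0X.
  exact: bounded_near0_comp.
(* The two sides agree up to [z ^ 4] times [F], which is bounded near 0. *)
have h0 : 0 < 1 / 2 :> C by rewrite divr_gt0.
have [||_ h1 h2 h3] := @coef_eq0_near0 (d 0%N - b 0%N) (d 1%N - b 1%N * c 1%N)
  (d 2%N - (b 1%N * c 2%N + b 2%N * c 1%N ^+ 2))
  (d 3%N - (b 1%N * c 3%N + 2 * b 2%N * c 1%N * c 2%N + b 3%N * c 1%N ^+ 3)) _ F h0 => //.
  move=> z zh; have z1 : inD z.
    by apply: le_lt_trans zh _; rewrite ltr_pdivrMr// mul1r ltr1n.
  have wE : psum c z = z * u z.
    by rewrite (psum_taylor3 tc z1) c0 /u /v /Om; ring.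
  have := dE z z1; rewrite (psum_taylor3 td z1) (psum_taylor3 tb (cD z z1)) wE.
  rewrite -/(D4 z) -/(Ga _) => /eqP; rewrite -subr_eq0 => /eqP <-.
  by rewrite /F /Q2 /Q3 /u /v; ring.
by split; apply/eqP; rewrite -subr_eq0; apply/eqP.
Qed.
End BoundedNearZero.

(** * The coefficient bound and the extremal function *)

Section Extremal.
Variable R : realType.
Local Notation C := R[i].
Implicit Types (a b c : nat -> C) (z : C).

Lemma near_inD z : inD z -> \forall x \near z, inD x.
Proof.
rewrite /inD => z1; apply/nbhs_ballP; exists (1 - `|z|) => /=; first by rewrite subr_gt0.
move=> x; rewrite /ball/= => xz; rewrite -[x](subrK z) (le_lt_trans (ler_normD _ _))//.
by rewrite -ltrBrDr distrC.
Qed.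

Lemma derive1_power_series (f : C -> C) a z : power_series_on_D f a -> inD z ->
  f^`() z = psum (dcoef a) z.
Proof.
move=> fa z1; have ta := power_series_tame fa; rewrite derive1E.
have df : is_derive z (1 : C) f (psum (dcoef a) z).
  (* [f] agrees with its sum on the disc only, which is enough since the derivative is local. *)
  apply: near_eq_is_derive (is_derive_psum ta z1).
  by apply: filterS (near_inD z1) => x x1; rewrite (power_series_psum fa).
by rewrite derive_val.
Qed.

Lemma coef_functional_le (c1 c2 c3 : C) :
  `|c1| ^+ 2 + `|c2| ^+ 2 + `|c3| ^+ 2 <= 1 ->
  `|c3 - 5 / 6 * (c1 * c2) - 1 / 8 * c1 ^+ 3| <= 1.
Proof.
move=> H.
have nn (z : C) : 0 <= Normc.normc z by case: z => x y; exact: sqrtr_ge0.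
have nE (z : C) : `|z| = (Normc.normc z)%:C by [].
pose x := Normc.normc c1; pose y := Normc.normc c2; pose w := Normc.normc c3.
have x0 : 0 <= x := nn _; have y0 : 0 <= y := nn _; have w0 : 0 <= w := nn _.
have xyw : x ^+ 2 + y ^+ 2 + w ^+ 2 <= 1.
  by rewrite -lecR !rmorphD !rmorphXn.
have bnd : w + 5 / 6 * (x * y) + 1 / 8 * x ^+ 3 <= 1.
  have x1 : x <= 1 by nra.
  (* [w <= (1 + w^2)/2] and [5/6 x y <= 25/72 x^2 + y^2/2], where 25/72 + 1/8 < 1/2 *)
  have h1 := sqr_ge0 (w - 1); have h2 := sqr_ge0 (5 / 6 * x - y).
  have h3 : x ^+ 3 <= x ^+ 2 by rewrite exprS ler_piMl// sqr_ge0.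
  by nra.
apply: (@le_trans _ _ (w + 5 / 6 * (x * y) + 1 / 8 * x ^+ 3)%:C); last by rewrite lecR.
apply: le_trans (ler_normB _ _) _; rewrite rmorphD lerD//.
  apply: le_trans (ler_normB _ _) _; rewrite rmorphD lerD//.
  rewrite !normrM normfV !normr_nat !nE !rmorphM fmorphV !rmorph_nat //.
by rewrite normrM normrX (normrM 1) normfV normr_nat normr1 nE rmorphM rmorphXn /= fmorph_div rmorph1 rmorph_nat.
Qed.

Lemma BT_coef_bound (f : C -> C) a : power_series_on_D f a -> classBT f ->
  `|a 2%N * a 3%N - a 4%N| <= 1 / 8.
Proof.
move=> fa [_ [w [[c wc] wD w0 fw]]].
have [b [[b0 b1 b2 b3] b_le1 bB _]] := Bfun_series R.
have tc := power_series_tame wc; have wE z (z1 : inD z) := power_series_psum wc z1.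
have ta := power_series_tame fa.
have c0 : c 0%N = 0 by rewrite -psum0 -wE ?w0//; exact: inD0.
have cD z : inD z -> inD (psum c z) by move=> z1; rewrite -wE//; exact: wD.
have [|d1 d2 d3] := comp_coef (tame_dcoef ta) (tame_bound b_le1) tc c0 cD.
  by move=> z z1; rewrite -(derive1_power_series fa z1) fw// wE// bB//; exact: cD.
have c1 z : inD z -> `|psum c z| <= 1 by move=> /cD/ltW.
have := Parseval_le 4 tc c1.
rewrite !big_ord_recl big_ord0 c0 normr0 expr0n add0r addr0 addrA => P.
(* The coefficient of index [k] of [f'] is [(k + 1) a_(k+1)], so [c1], [c2], [c3] determine [a2],
   [a3], [a4]. *)
move: d1 d2 d3; rewrite /dcoef b1 b2 b3 => d1 d2 d3.
have n2 : 2 != 0 :> C by rewrite pnatr_eq0.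
have n3 : 3 != 0 :> C by rewrite pnatr_eq0.
have n4 : 4 != 0 :> C by rewrite pnatr_eq0.
have a2 : a 2%N = c 1%N / 4 by apply: (mulfI n2); rewrite d1; field.
have a3 : a 3%N = c 2%N / 6 - c 1%N ^+ 2 / 24 by apply: (mulfI n3); rewrite d2; field.
have a4 : a 4%N = c 3%N / 8 - c 1%N * c 2%N / 16 - 5 * c 1%N ^+ 3 / 192.
  by apply: (mulfI n4); rewrite d3; field.
have -> : a 2%N * a 3%N - a 4%N =
    - (1 / 8) * (c 3%N - 5 / 6 * (c 1%N * c 2%N) - 1 / 8 * c 1%N ^+ 3).
  by rewrite a2 a3 a4; field.
rewrite normrM normrN normrM normfV normr1 normr_nat ler_piMr ?divr_ge0//.
exact: coef_functional_le.
Qed.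

Definition spread3 b : nat -> C := fun n => if (3 %| n)%N then b (n %/ 3)%N else 0.

(** The partial sums in [z^3] are every third partial sum of the spread series, hence have the same
    limit. *)
Lemma psum_spread3 b z : (forall n, `|b n| <= 1) -> inD z ->
  psum (spread3 b) z = psum b (z ^+ 3).
Proof.
move=> b1 z1; apply/esym/psum_unique.
have ts : tame (spread3 b).
  by apply: (@tame_bound _ _ 1) => n; rewrite /spread3; case: ifP; rewrite ?normr0.
have := psumP ts z1.
set s := series _ => sl.
have -> : series (fun n => b n * (z ^+ 3) ^+ n) = (fun n => s (3 * n)%N).
  apply/funext; elim => [|n IH]; first by rewrite /s /series /= !big_geq.
  rewrite mulnS !addSn add0n; rewrite /series /= in IH *; rewrite /s /series /=.
  rewrite !big_nat_recr//= IH /s /series /= /spread3 dvdn_mulr// mulKn//.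
  have -> : (3 %| (3 * n).+1)%N = false by rewrite -[X in (3 %| X)%N]addn1 dvdn_addr// dvdn_mulr.
  have -> : (3 %| (3 * n).+2)%N = false by rewrite -[X in (3 %| X)%N]addn2 dvdn_addr// dvdn_mulr.
  by rewrite !mul0r !addr0 exprM.
apply: (@cvg_comp _ _ _ (fun n => (3 * n)%N) s _ \oo) sl.
by move=> E [N _ HN]; exists N => // n /= Nn; apply: HN => /=; rewrite (leq_trans Nn)// leq_pmull.
Qed.

Lemma extremal : exists (f : C -> C) a,
  [/\ power_series_on_D f a, classBT f, f 0 = 0,
      (forall z, inD z -> f^`() z = Bfun (z ^+ 3)) &
      `|a 2%N * a 3%N - a 4%N| = 1 / 8].
Proof.
have [b [[b0 b_1 _ _] b1 bB bRe]] := Bfun_series R.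
pose c := spread3 b.
have c1 n : `|c n| <= 1 by rewrite /c /spread3; case: ifP; rewrite ?normr0.
(* Termwise primitive of [c], vanishing at 0: the integral defining the extremal function. *)
pose a n : C := if n is m.+1 then c m / m.+1%:R else 0.
have a1 n : `|a n| <= 1.
  case: n => [|n] /=; first by rewrite normr0.
  rewrite normrM normfV normr_nat ler_pdivrMr ?ltr0n// mul1r.
  by rewrite (le_trans (c1 n))// ler1n.
have ta := tame_bound a1.
have dE : dcoef a = c.
  by apply/funext => n; rewrite /dcoef /a mulrC divfK// pnatr_eq0.
have fa : power_series_on_D (psum a) a by move=> z z1; exact: psumP.
have z3 z : inD z -> inD (z ^+ 3).
  by rewrite /inD normrX => z1; rewrite exprn_ilt1.
have df z : inD z -> is_derive z (1 : C) (psum a) (psum c z).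
  by move=> z1; rewrite -dE; exact: is_derive_psum.
have f' z : inD z -> (psum a)^`() z = psum c z.
  by move=> z1; rewrite (derive1_power_series fa z1) dE.
have cE z : inD z -> psum c z = psum b (z ^+ 3).
  by move=> z1; exact: psum_spread3.
have f'B z : inD z -> (psum a)^`() z = Bfun (z ^+ 3).
  by move=> z1; rewrite f'// cE// bB//; exact: z3.
exists (psum a), a; split => //; last 1 first.
(* Only [a4 = b1 / 4 = 1/8] matters: [a2 = c1 / 2] vanishes as 3 does not divide 1. *)
- have -> : a 2%N = 0 by rewrite /a /c /spread3 /= mul0r.
  have -> : a 4%N = 1 / 8 by rewrite /a /c /spread3 /= b_1; field.
  by rewrite mul0r sub0r normrN ger0_norm ?divr_ge0.
- split; last first.
    exists (fun z => z ^+ 3); split => //; last by rewrite expr0n.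
    exists (fun n => if n == 3%N then 1 else 0) => z z1.
    apply/cvgrPdist_lt => e e0; exists 4%N => //= n n4.
    rewrite /series /= big_mkord (bigD1 (Ordinal n4))//= mul1r big1 ?addr0 ?subrr ?normr0//.
    by move=> i /negPf i3; rewrite -val_eqE /= in i3; rewrite i3 mul0r.
  split; first by exists a.
  + move=> z v z1 v1 zv; apply/eqP; rewrite eq_sym -subr_eq0; apply/eqP.
    set h := v - z; apply/eqP/negPn/negP => h0.
    have zh : inD (z + h) by rewrite subrKC.
    (* With the conjugate of [h] as multiplier, the right side is [|h|^2 Re f'(x)], positive for
       [h != 0], while the increment of the function is 0. *)
    have [x x1] := complex_MVT (h^*)%C df z1 zh.
    have Rx := bRe _ (z3 x x1); rewrite -cE// in Rx.
    rewrite subrKC zv subrr mulr0 mulrAC [X in X * _]mulrC -sqr_normc -add_Re2_Im2.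
    case: (psum c x) Rx => p q /= p0; rewrite mul0r subr0 => /esym/eqP.
    rewrite mulf_eq0 (gt_eqF p0) orbF paddr_eq0 ?sqr_ge0// !sqrf_eq0.
    by move: h0; rewrite eq_complex => /negP.
  + by rewrite psum0.
  + by rewrite f' ?psum0//; exact: inD0.
- by rewrite psum0.
Qed.
End Extremal.

Theorem theorem5p1 (R : realType) :
  (forall (f : R[i] -> R[i]) (a : nat -> R[i]),
     power_series_on_D f a -> classBT f ->
     `|a 2%N * a 3%N - a 4%N| <= 1 / 8) /\
  (* sharpness: f_3(z) = int_0^z sqrt(1 + tanh(t^3)) dt, i.e. f_3(0) = 0 and
     f_3'(z) = B(z^3) on D, lies in the class and attains equality *)
  (exists (f : R[i] -> R[i]) (a : nat -> R[i]),
     [/\ power_series_on_D f a, classBT f, f 0 = 0,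
         (forall z, inD z -> f^`() z = Bfun (z ^+ 3)) &
         `|a 2%N * a 3%N - a 4%N| = 1 / 8]).
Proof.
by split; [exact: BT_coef_bound|exact: extremal].
Qed.
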